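(* Let $r>0$ and assume $W$ satisfies (H). Then there exists a local minimizer $u\in L^\infty(\mathbb{R})$ of $\mathcal{E}$ which is monotone nondecreasing and satisfies $\lim_{x\to\pm\infty}u(x)=\pm1$. Moreover $$\mathcal{E}(u)=\min\Big\{\mathcal{E}(v)\ :\ v\in L^\infty(\mathbb{R})\text{ monotone nondecreasing with }\lim_{x\to\pm\infty}v(x)=\pm1\Big\}\le \min\Big\{\frac4r,\,4+c_W\Big\}.$$
   Context: Fix $r>0$. For an interval $I\subset\mathbb{R}$ and $u\in L^\infty(I)$, $\operatorname{osc}_I u:=\operatorname{ess\,sup}_I u-\operatorname{ess\,inf}_I u$. For $a<b$ with $b-a>2r$ and $u\in L^\infty_{\rm loc}(\mathbb{R})$, $$\mathcal{E}_{(a,b)}(u):=\frac1{2r^2}\int_a^b\Big(\operatorname{osc}_{(x-r,x+r)}u\Big)^2dx+\int_a^b W(u(x))\,dx,$$ and $\mathcal{E}(u):=\frac1{2r^2}\int_{\mathbb{R}}(\operatorname{osc}_{(x-r,x+r)}u)^2dx+\int_{\mathbb{R}}W(u(x))dx$. A function $u\in L^\infty_{\rm loc}(\mathbb{R})$ is a local minimizer of $\mathcal{E}$ if for all $a<b$ and all $v\in L^\infty_{\rm loc}(\mathbb{R})$ with $u=v$ a.e. outside $[a+r,b-r]$ one has $\mathcal{E}_{(a,b)}(u)\le\mathcal{E}_{(a,b)}(v)$. Assumption (H) on $W$: $W\in C(\mathbb{R})$, $W(-1)=W(1)=0<W(t)$ for all $t\ne\pm1$; $W$ is strictly decreasing on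 $(-\infty,-1)$ and strictly increasing on $(1,+\infty)$; $W$ is even on $[-1,1]$ and has a unique local maximum in $[-1,1]$, at $t=0$. Set $c_W:=\int_{-1}^1W(s)\,ds>0$. Limits of $L^\infty$ functions are understood in the essential sense. *)

(* Defs.v *)
From Stdlib Require Import Reals Lra List Classical ClassicalEpsilon.
Open Scope R_scope.

Definition Rsup (S : R -> Prop) : R :=
  match excluded_middle_informative (bound S /\ exists x, S x) with
  | left H => proj1_sig (completeness S (proj1 H) (proj2 H))
  | right _ => 0
  end.

Inductive ER : Type := Fin (x : R) | PInf.

Definition ER_le (x y : ER) : Prop :=
  match x, y with
  | Fin a, Fin b => a <= b
  | _, PInf => True
  | PInf, Fin _ => False
  end.

Definition ER_plus (x y : ER) : ER :=
  match x, y with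
  | Fin a, Fin b => Fin (a + b)
  | _, _ => PInf
  end.

Definition ER_sup (S : R -> Prop) : ER :=
  if excluded_middle_informative (bound S) then Fin (Rsup S) else PInf.

Definition cover_sum (A : R -> Prop) (s : R) : Prop :=
  exists a b : nat -> R,
    (forall n, a n <= b n) /\
    (forall x, A x -> exists n, a n < x < b n) /\
    Un_cv (fun N => sum_f_R0 (fun n => b n - a n) N) s.

Definition null (A : R -> Prop) : Prop :=
  forall eps, 0 < eps -> exists s, cover_sum A s /\ s <= eps.

Definition outer_is (A : R -> Prop) (m : R) : Prop :=
  (forall s, cover_sum A s -> m <= s) /\
  (forall m', (forall s, cover_sum A s -> m' <= s) -> m' <= m).

Definition measurable_set (E : R -> Prop) : Prop :=
  forall eps, 0 < eps -> exists G : R -> Prop,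
    open_set G /\ (forall x, E x -> G x) /\
    exists s, cover_sum (fun x => G x /\ ~ E x) s /\ s <= eps.

Definition measurable_fun (u : R -> R) : Prop :=
  forall t, measurable_set (fun x => t < u x).

Definition indic (E : R -> Prop) (c x : R) : R :=
  if excluded_middle_informative (E x) then c else 0.

(* s is the integral of a nonnegative simple function below f;
   each triple (c, E, m) is a coefficient c >= 0, a measurable set E, and
   its (finite) measure m *)
Definition simple_below (f : R -> R) (s : R) : Prop :=
  exists l : list (R * (R -> Prop) * R),
    (forall c E m, In (c, E, m) l ->
        0 <= c /\ measurable_set E /\ outer_is E m) /\
    (forall x, fold_right (fun t acc => indic (snd (fst t)) (fst (fst t)) x + acc) 0 l
               <= f x) /\
    s = fold_right (fun t acc => fst (fst t) * snd t + acc) 0 l.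

Definition integral (f : R -> R) : ER := ER_sup (simple_below f).

Definition restrict (a b : R) (f : R -> R) (x : R) : R :=
  if excluded_middle_informative (a < x < b) then f x else 0.

Definition ess_sup (c d : R) (u : R -> R) : R :=
  - Rsup (fun y => null (fun x => c < x < d /\ - y < u x)).
Definition ess_inf (c d : R) (u : R -> R) : R :=
  Rsup (fun m => null (fun x => c < x < d /\ u x < m)).
Definition osc (c d : R) (u : R -> R) : R := ess_sup c d u - ess_inf c d u.

Definition Linfty_loc (u : R -> R) : Prop :=
  measurable_fun u /\
  forall a b, exists M, null (fun x => a < x < b /\ M < Rabs (u x)).
Definition Linfty (u : R -> R) : Prop :=
  measurable_fun u /\ exists M, null (fun x => M < Rabs (u x)).

Definition osc_term (r : R) (u : R -> R) (x : R) : R :=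
  (osc (x - r) (x + r) u) ^ 2 / (2 * r ^ 2).

Definition energy_ab (r : R) (W : R -> R) (a b : R) (u : R -> R) : ER :=
  ER_plus (integral (restrict a b (osc_term r u)))
          (integral (restrict a b (fun x => W (u x)))).

Definition energy (r : R) (W : R -> R) (u : R -> R) : ER :=
  ER_plus (integral (osc_term r u)) (integral (fun x => W (u x))).

Definition local_minimizer (r : R) (W : R -> R) (u : R -> R) : Prop :=
  forall (a b : R) (v : R -> R),
    a < b -> Linfty_loc v ->
    null (fun x => ~ (a + r <= x <= b - r) /\ u x <> v x) ->
    ER_le (energy_ab r W a b u) (energy_ab r W a b v).

Definition nondecreasing (u : R -> R) : Prop := forall x y, x <= y -> u x <= u y.

Definition has_limits_pm1 (u : R -> R) : Prop :=
  (forall eps, 0 < eps -> exists M, forall x, M < x -> Rabs (u x - 1) < eps) /\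
  (forall eps, 0 < eps -> exists M, forall x, x < M -> Rabs (u x + 1) < eps).

Definition local_max_on_m11 (W : R -> R) (t0 : R) : Prop :=
  -1 <= t0 <= 1 /\
  exists delta, 0 < delta /\
    forall t, -1 <= t <= 1 -> Rabs (t - t0) < delta -> W t <= W t0.

Definition hyp_H (W : R -> R) : Prop :=
  continuity W /\
  W (-1) = 0 /\ W 1 = 0 /\
  (forall t, t <> -1 -> t <> 1 -> 0 < W t) /\
  (forall s t, s < t < -1 -> W t < W s) /\
  (forall s t, 1 < s < t -> W s < W t) /\
  (forall t, -1 <= t <= 1 -> W (- t) = W t) /\
  local_max_on_m11 W 0 /\
  (forall t0, local_max_on_m11 W t0 -> t0 = 0).

(* Main.v *)
(* Both the upper and the lower estimates go through monotone functions.  For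
   nondecreasing [u] the oscillation over [(x - r, x + r)] is at most
   [u (x + r) - u (x - r)]; call "increment energy" the energy with the oscillation
   replaced by this increment.  Helly's selection theorem and Fatou's lemma give a
   minimizer [u] of the increment energy among nondecreasing functions with values
   in [[-1, 1]] that change sign at [0]; finiteness of the potential term forces the
   limits [-1] and [1].

   Conversely let [v] tend to [-1] and [1].  Round [v] outwards to finitely many
   levels, which lowers the potential and raises the oscillation by little.  The
   squared oscillation of a function with equally spaced levels is a double sum of
   indicators of [A_r /\ B_r], where [A] is a superlevel set, [B] a sublevel set, and
   the subscript is the (essential) [r]-neighbourhood; one has
   [|A_r /\ B_r| >= 2 r - |complement of A \/ B|], with equality when [A] and [B]
   are half-lines.  So the monotone rearrangement of the rounded [v] has increment
   energy at most the energy of [v] up to a small error, and [u] beats [v].  Applied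
   to compact perturbations [v] of [u] this is local minimality.

   The bound [4 / r] is the energy of the sign function, and [4 + c_W] is the limit
   of the energies of staircases approximating [x] on [[-1, 1]]. *)
From Pilot Require Import Defs.
From Stdlib Require Import Reals Lra Lia List ClassicalEpsilon.

Open Scope R_scope.

(** * The potential *)

(** The increment replaces the oscillation because it depends on two values only: it passes to the
    limit wherever the values at [x + r] and [x - r] do, and for a staircase it is exactly a sum of
    indicators of intervals of length [2 r]. The price is only the easy inequality between
    oscillation and increment; comparing [u] with itself shows afterwards that its two energies
    agree. The rounding has to cope with a [v] that approaches -1 and 1 without reaching them. All
    thresholds therefore lie in an interval from [- k] to [k] with [k < 1]: beyond some [L] none is
    crossed, so the layers between thresholds have finite measure and can be rearranged. Shrinking
    costs a factor [k ^- 2] on the squared oscillation, and rounding with step [h] costs a multiple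
    of [h] on a bounded interval. Since [L] depends on [k], the step [h] is chosen last. Local
    minimality follows by cancelling the common energy outside the perturbed interval, which is
    where finiteness of the energy enters. *)

Lemma IZR4 : IZR 4 = R1 + (R1 + (R1 + R1)).
Proof. change R1 with 1; lra. Qed.
Lemma well_nonneg (W : R -> R) (t : R) : hyp_H W -> 0 <= W t.
Proof.
intros (_ & Wm & W1 & Wpos & _).
destruct (Req_dec t (-1)) as [->|n1]; [lra|].
destruct (Req_dec t 1) as [->|n2]; [lra|].
apply Rlt_le, Wpos; assumption.
Qed.
(* A failure of monotonicity would put the maximum of [W] over [[s, 1]] at an
   interior point, i.e. at a second local maximum. *)
Lemma well_decreasing (W : R -> R) (s t : R) : hyp_H W ->
  0 <= s -> s <= t -> t <= 1 -> W t <= W s.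
Proof.
intros HW s0 st t1; destruct (Rle_lt_dec (W t) (W s)) as [h|h]; [exact h|exfalso].
pose proof (well_nonneg W s HW) as Ws0.
destruct HW as (Wc & Wm & W1 & Wpos & _ & _ & _ & _ & Wuniq).
destruct (continuity_ab_maj W s 1) as [p [pmax [sp p1]]]; [lra|intros; apply Wc|].
assert (Wp : W s < W p) by (specialize (pmax t); lra).
assert (ps : s < p) by (destruct sp as [sp|sp]; [exact sp|subst; lra]).
assert (pl1 : p < 1) by (destruct p1 as [p1|p1]; [exact p1|subst; lra]).
enough (p = 0) by lra.
apply Wuniq; split; [lra|].
exists (Rmin (p - s) (1 - p)); split; [apply Rmin_glb_lt; lra|].
intros x x1 xp; apply pmax.
pose proof (Rmin_l (p - s) (1 - p)); pose proof (Rmin_r (p - s) (1 - p)).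
apply Rabs_def2 in xp; lra.
Qed.
Lemma well_increasing (W : R -> R) (s t : R) : hyp_H W ->
  -1 <= s -> s <= t -> t <= 0 -> W s <= W t.
Proof.
intros HW s1 st t0; assert (even : forall x, -1 <= x <= 1 -> W (- x) = W x) by apply HW.
rewrite <- (even s), <- (even t) by lra.
apply well_decreasing; [exact HW|lra..].
Qed.
Lemma RiemannInt_ge_cst (f : R -> R) (a b c : R) (pr : Riemann_integrable f a b) :
  a <= b -> (forall x, a < x < b -> c <= f x) -> c * (b - a) <= RiemannInt pr.
Proof.
intros ab cf; rewrite <- (RiemannInt_P15 (RiemannInt_P14 a b c)).
apply RiemannInt_P19; [exact ab|exact cf].
Qed.
(** Only interior nodes occur: with [h * INR N = 1] and [2 N - 1] terms both endpoints are left out.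
    It is the potential energy of a staircase that stays on each of these levels for a length
    [h]. *)
Fixpoint riemann_sum (W : R -> R) (h : R) (k : nat) : R :=
  match k with
  | O => 0
  | S k => riemann_sum W h k + W (-1 + h * INR (S k)) * h
  end.
(* Every node other than [0] is matched with the adjacent cell on its inner side,
   on which [W] is at least its value at the node. *)
Lemma riemann_sum_le (W : R -> R) (h : R) (N : nat) (pr : Riemann_integrable W (-1) 1) :
  hyp_H W -> (0 < N)%nat -> h * INR N = 1 ->
  riemann_sum W h (pred (N + N)) <= RiemannInt pr + h * W 0.
Proof.
intros HW N0 hN.
assert (Np : 0 < INR N) by (apply lt_0_INR; exact N0).
assert (h0 : 0 < h) by nra.
assert (P : forall a b, Riemann_integrable W a b).
{ intros a b; destruct (Rle_dec a b) as [ab|ab].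
  - apply continuity_implies_RiemannInt; [exact ab|intros; apply HW].
  - apply RiemannInt_P1, continuity_implies_RiemannInt; [lra|intros; apply HW]. }
pose (J a b := RiemannInt (P a b)).
assert (chasles : forall a b c, J a c = J a b + J b c).
{ intros a b c; symmetry; apply RiemannInt_P26. }
assert (cell : forall a b c, a <= b -> (forall x, a < x < b -> c <= W x) -> c * (b - a) <= J a b).
{ intros; apply RiemannInt_ge_cst; assumption. }
pose (t k := -1 + h * INR k).
assert (tS : forall k, t (S k) = t k + h) by (intros k; unfold t; rewrite S_INR; ring).
assert (tN : t N = 0) by (unfold t; lra).
assert (tmono : forall i j, (i <= j)%nat -> t i <= t j).
{ intros i j ij; unfold t; apply le_INR in ij; nra. }
assert (t0 : forall k, -1 <= t k).
{ intros k; unfold t; pose proof (pos_INR k); nra. }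
assert (A : forall k, (k < N)%nat -> riemann_sum W h k <= J (-1) (t (S k))).
{ induction k as [|k IH]; intros kN; simpl riemann_sum.
  - rewrite <- (Rmult_0_l (t 1%nat - -1)); apply cell; [apply t0|].
    intros x _; apply well_nonneg, HW.
  - rewrite (chasles _ (t (S k))); apply Rplus_le_compat; [apply IH; lia|].
    change (-1 + h * _) with (t (S k)).
    replace (W (t (S k)) * h) with (W (t (S k)) * (t (S (S k)) - t (S k)))
      by (rewrite (tS (S k)); ring).
    apply cell; [apply tmono; lia|].
    intros x hx; apply well_increasing; [exact HW|apply t0|lra|].
    rewrite <- tN; apply Rle_trans with (t (S (S k))); [lra|apply tmono; lia]. }
(* The node [0] has no cell on its inner side; it accounts for the term [h * W 0]. *)
assert (B : forall k, (k < N)%nat -> riemann_sum W h (N + k) <= J (-1) (t (N + k)%nat) + h * W 0).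
{ induction k as [|k IH]; intros kN.
  - rewrite Nat.add_0_r; destruct N as [|N']; [lia|]; simpl riemann_sum.
    change (-1 + h * _) with (t (S N')); rewrite tN.
    pose proof (A N' ltac:(lia)) as AN; rewrite tN in AN; lra.
  - rewrite Nat.add_succ_r; simpl riemann_sum.
    change (-1 + h * _) with (t (S (N + k))).
    rewrite (chasles _ (t (N + k)%nat) (t (S (N + k)))).
    enough (W (t (S (N + k))) * h <= J (t (N + k)%nat) (t (S (N + k)))).
    { specialize (IH ltac:(lia)); lra. }
    replace (W (t (S (N + k))) * h) with (W (t (S (N + k))) * (t (S (N + k)) - t (N + k)%nat))
      by (rewrite (tS (N + k)%nat); ring).
    apply cell; [apply tmono; lia|].
    intros x hx; apply well_decreasing; [exact HW| |lra|].
    + assert (t N <= t (N + k)%nat) by (apply tmono; lia); lra.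
    + assert (t (S (N + k)) <= t (N + N)%nat) by (apply tmono; lia).
      assert (t (N + N)%nat = 1) by (unfold t; rewrite plus_INR; lra); lra. }
replace (pred (N + N)) with (N + (N - 1))%nat by lia.
specialize (B (N - 1)%nat ltac:(lia)).
assert (tl : t (N + (N - 1))%nat <= 1).
{ assert (t (N + (N - 1))%nat <= t (N + N)%nat) by (apply tmono; lia).
  assert (t (N + N)%nat = 1) by (unfold t; rewrite plus_INR; lra); lra. }
assert (last : 0 * (1 - t (N + (N - 1))%nat) <= J (t (N + (N - 1))%nat) 1).
{ apply cell; [exact tl|intros x _; apply well_nonneg, HW]. }
assert (E : RiemannInt pr = J (-1) 1) by apply RiemannInt_P5.
rewrite E, (chasles _ (t (N + (N - 1))%nat)); lra.
Qed.

From mathcomp Require Import all_boot all_order all_algebra.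
From mathcomp Require Import all_classical all_reals all_analysis measurable_realfun.
From mathcomp Require Import ring lra.
Set Implicit Arguments. Unset Strict Implicit. Unset Printing Implicit Defensive.
Import Order.TTheory GRing.Theory Num.Theory.
Import numFieldNormedType.Exports.
Local Open Scope classical_set_scope.
Local Open Scope ring_scope.

(** * Lebesgue measure *)

Section lebesgue.
Context {R : realType}.

(** The Carathéodory sigma-algebra, not the Borel one: [measurable_set] describes Lebesgue
    measurable sets, and every null set has to be measurable. *)
Definition leb_type : measurableType _ :=
  caratheodory_type ((@wlength R idfun)^*)%mu.

Definition leb : {measure set leb_type -> \bar R} := @completed_lebesgue_measure R.

Implicit Types (f : leb_type -> R) (A B : set leb_type).

Lemma borel_leb_measurable (A : set (measurableTypeR R)) :
  measurable A -> measurable (A : set leb_type).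
Proof. by move=> mA; apply: sub_caratheodory. Qed.

Lemma open_leb_measurable (A : set R) : open A -> measurable (A : set leb_type).
Proof. by move=> oA; apply: borel_leb_measurable; exact: open_measurable. Qed.

Lemma leb_itv (i : interval R) :
  leb [set` i] = (if i.1 < i.2 then (i.2 : \bar R) - i.1 else 0)%E.
Proof. exact: lebesgue_measure_itv. Qed.

Lemma itv_leb_measurable (i : interval R) : measurable ([set` i] : set leb_type).
Proof. by apply: borel_leb_measurable; exact: measurable_itv. Qed.

Lemma borel_leb_measurable_fun (f : R -> R) :
  measurable_fun setT f -> measurable_fun setT (f : leb_type -> R).
Proof.
move=> mf _ Y mY; rewrite setTI; apply: borel_leb_measurable.
by rewrite -[X in measurable X]setTI; exact: mf.
Qed.

Lemma leb_measurable_funP f :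
  measurable_fun setT f <-> forall t, measurable [set x : leb_type | t < f x].
Proof.
split=> [mf t|mf].
  rewrite (_ : [set x | _] = setT `&` f @^-1` `]t, +oo[).
    exact: mf.
  by rewrite setTI; apply/seteqP; split=> x /=; rewrite in_itv/= andbT.
apply: (measurability (@RGenOInfty.G R)); first exact: RGenOInfty.measurableE.
move=> _ [_ [t ->] <-]; rewrite setTI.
rewrite (_ : _ @^-1` _ = [set x | t < f x]) //.
by apply/seteqP; split=> x /=; rewrite in_itv/= andbT.
Qed.

Lemma leb_eq0_measurable A : (leb A = 0)%E -> measurable A.
Proof.
move=> A0; apply: negligible_sub_caratheodory.
have /negligible_outer_measure[B [mB B0 AB]] : ((@wlength R idfun)^* A = 0)%mu by [].
by exists B; split => //; exact: sub_caratheodory.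
Qed.

(** [leb] is an outer measure on all sets, so monotonicity asks for no measurability. *)
Lemma leb_le A B : A `<=` B -> (leb A <= leb B)%E.
Proof. by move=> AB; apply: (@le_mu_ext _ _ _ (wlength idfun)). Qed.

Lemma leb_setU A B : measurable A -> measurable B ->
  (leb (A `|` B) <= leb A + leb B)%E.
Proof. by move=> mA mB; exact: measureU2. Qed.

End lebesgue.

(** * Fattening of sets *)

Section window.
Context {R : realType}.
Notation mu := (@leb R).
Notation T := (@leb_type R).
Variable K : R.
Implicit Types A B C : set T.

(** The sets to be compared contain half-lines; inside a bounded window their measures are finite
    and inclusion-exclusion can be done with real numbers. *)
Definition window_measure A : R := fine (mu (A `&` `]- K, K[)).
Local Notation m := window_measure.
Local Notation W := (`]- K, K[%classic : set T).

Lemma window_measure_lty A : measurable A -> (mu (A `&` W) < +oo)%E.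
Proof.
move=> mA; apply: (@le_lt_trans _ _ (mu W)).
  by apply: leb_le; exact: subIsetr.
rewrite leb_itv /= lte_fin; case: ifP => // _.
by rewrite -EFinB ltry.
Qed.

Lemma window_measureE A : measurable A -> ((m A)%:E = mu (A `&` W))%E.
Proof.
move=> mA; rewrite /m fineK//.
by rewrite ge0_fin_numE ?measure_ge0//; exact: window_measure_lty.
Qed.

Lemma window_measure_le_leb A : measurable A -> ((m A)%:E <= mu A)%E.
Proof. by move=> mA; rewrite window_measureE//; apply: leb_le; exact: subIsetl. Qed.

Lemma window_measure_ge0 A : 0 <= m A.
Proof. by rewrite /m fine_ge0. Qed.

Lemma window_measure_le A B : measurable A -> measurable B -> A `<=` B -> m A <= m B.
Proof.
move=> mA mB AB; rewrite -lee_fin !window_measureE//.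
by apply: leb_le; exact: setSI.
Qed.

Lemma window_measure_split A C : measurable A -> measurable C ->
  m A = m (A `&` C) + m (A `\` C).
Proof.
move=> mA mC; apply: EFin_inj; rewrite EFinD.
have mAC := measurableI _ _ mA mC; have mAD := measurableD mA mC.
have mW : measurable W by exact: itv_leb_measurable.
rewrite !window_measureE// -measureU//=; last 3 first.
- exact: measurableI.
- exact: measurableI.
- by apply/seteqP; split=> x //= -[[[_ ?] _] [[_ ?] _]].
congr (mu _); apply/seteqP; split=> x /=; last by case=> -[[? ?] ?].
by case=> Ax Wx; have [Cx|Cx] := pselect (C x); [left|right].
Qed.

Lemma window_measure_itv (a b : R) : - K <= a -> a <= b -> b <= K -> m `]a, b[%classic = b - a.
Proof.
move=> Ka ab bK; apply: EFin_inj; rewrite window_measureE; last exact: itv_leb_measurable.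
rewrite (_ : _ `&` _ = `]a, b[%classic); last first.
  apply/seteqP; split=> x /=; rewrite !in_itv/=; first by case.
  by move=> /andP[? ?]; split; apply/andP; split; lra.
rewrite leb_itv /= lte_fin; move: ab; rewrite le_eqVlt => /predU1P[->|->].
  by rewrite ltxx subrr.
by rewrite EFinB.
Qed.

Lemma window_measure_eq0 A : measurable A -> mu A = 0%E -> m A = 0.
Proof.
move=> mA A0; apply/eqP; rewrite eq_le window_measure_ge0 andbT.
by have := window_measure_le_leb mA; rewrite A0 lee_fin.
Qed.

Lemma window_measureT : 0 <= K -> m setT = 2 * K.
Proof.
move=> K0; have -> : m setT = m W by rewrite /m setTI setIid.
by rewrite window_measure_itv//; lra.
Qed.

End window.

Section fattening.
Context {R : realType}.
Notation mu := (@leb R).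
Notation T := (@leb_type R).
Variable r : R.
Implicit Types A B C : set T.

(** Asking for positive measure instead of a nonempty intersection makes this insensitive to null
    sets, as essential suprema and infima are. *)
Definition fattening A : set R := [set x | mu (A `&` `]x - r, x + r[) != 0%E].

(** Otherwise the part of [A] in []a, b[] would be carried, up to a null set, by two end strips of
    total length at most any given [e]. *)
Lemma leb_shrink_itv A (a b : R) : measurable A -> a < b ->
  mu (A `&` `]a, b[) != 0%E ->
  exists2 d : R, 0 < d & mu (A `&` `]a + d, b - d[) != 0%E.
Proof.
move=> mA ab nz; apply: contrapT => h.
have h0 (d : R) : 0 < d -> mu (A `&` `]a + d, b - d[) = 0%E.
  move=> d0; apply: contrapT => /eqP ?; apply: h.
  by exists d.
move/eqP: nz; apply; apply/eqP; rewrite eq_le measure_ge0 andbT.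
apply/lee_addgt0Pr => e e0; rewrite add0e.
have mi (i : interval R) : measurable ([set` i] : set T) := itv_leb_measurable i.
pose d := Num.min (e / 2) ((b - a) / 3).
have d0 : 0 < d by rewrite lt_min; apply/andP; split; lra.
have de : d <= e / 2 by rewrite ge_min lexx.
apply: (@le_trans _ _ (mu ((A `&` `]a + d, b - d[) `|` (`]a, a + d] `|` `[b - d, b[)))).
  apply: leb_le => x /= -[Ax]; rewrite !in_itv/= => /andP[ax xb].
  have [xad|adx] := leP x (a + d); first by rewrite ax; right; left.
  have [bdx|xbd] := leP (b - d) x; first by rewrite xb; right; right.
  by left.
apply: (le_trans (leb_setU _ _)) => //.
- exact: measurableI.
- exact: measurableU.
rewrite (h0 d d0) add0e; apply: (le_trans (leb_setU _ _)) => //.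
rewrite !leb_itv /= !lte_fin; rewrite ifT; last by lra.
rewrite ifT; last by lra.
by rewrite -!EFinB -EFinD lee_fin; lra.
Qed.

Lemma fattening_near A (x : R) : 0 < r -> measurable A -> fattening A x ->
  exists2 d : R, 0 < d & forall y, `|x - y| < d -> fattening A y.
Proof.
move=> r0 mA Ax; have xr : x - r < x + r by lra.
have [d d0 dA] := leb_shrink_itv mA xr Ax.
exists d => // y; rewrite ltr_norml => /andP[xy1 xy2].
apply: contra dA => /eqP Ay; rewrite eq_le measure_ge0 andbT -Ay.
apply: leb_le => z /= [Az]; rewrite !in_itv/= => /andP[? ?].
by split => //; apply/andP; split; lra.
Qed.

Lemma open_fattening A : 0 < r -> measurable A -> open (fattening A).
Proof.
by move=> r0 mA; rewrite openE => x /(fattening_near r0 mA)[d d0 dA]; exists d.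
Qed.

Lemma measurable_fattening A : 0 < r -> measurable A -> measurable (fattening A : set T).
Proof. by move=> r0 /(open_fattening r0)/open_leb_measurable. Qed.

(** Cut the window into cells of length [r]. A cell that contains a point [x] of [A] outside the
    fattening lies in []x - r, x + r[], where [A] is null by the choice of [x]; no density theorem
    is involved. *)
Lemma window_measure_diff_fattening (K : R) A : 0 < r -> measurable A ->
  window_measure K (A `\` fattening A) = 0.
Proof.
move=> r0 mA; have mF := measurable_fattening r0 mA.
apply: EFin_inj; rewrite window_measureE; last exact: measurableD.
apply/eqP; rewrite eq_le measure_ge0 andbT.
pose J n : set T := (A `\` fattening A) `&` `[- K + n%:R * r, - K + n.+1%:R * r[.
have mJ n : measurable (J n).
  by apply: measurableI; [exact: measurableD|exact: itv_leb_measurable].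
have J0 n : mu (J n) = 0%E.
  have [[x [[Ax Fx] Jx]]|] := pselect (exists x, J n x); last first.
    move=> h; rewrite (_ : J n = set0) ?measure0//.
    by apply/seteqP; split => x // Jx; apply: h; exists x.
  move: Fx => /= /negP; rewrite negbK => /eqP A0.
  apply/eqP; rewrite eq_le measure_ge0 andbT -A0; apply: leb_le => y /= [[Ay _]].
  move: Jx; rewrite /= !in_itv/= => /andP[? ?] /andP[? ?].
  have E : n.+1%:R * r = n%:R * r + r by rewrite -natr1 mulrDl mul1r.
  by split => //; apply/andP; split; lra.
apply: (@le_trans _ _ (\sum_(n <oo) mu (J n))%E); last first.
  by rewrite eseries0 // => n _ _; exact: J0.
apply: measure_sigma_subadditive => //.
  by apply: measurableI; [exact: measurableD|exact: itv_leb_measurable].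
move=> x /= [Fx]; rewrite in_itv/= => /andP[Kx xK].
exists (Num.truncn ((x + K) / r)) => //; split => //.
rewrite /= in_itv/=.
have /truncn_itv/andP[h1 h2] : 0 <= (x + K) / r by apply: divr_ge0; lra.
apply/andP; split.
  by move: h1; rewrite ler_pdivlMr// => ?; lra.
by move: h2; rewrite ltr_pdivrMr// => ?; lra.
Qed.

(** The fattening contains almost all of [A] and, in addition, an interval of length [r] that [A]
    misses. *)
Lemma window_measure_fattening_ge K A (a : R) : 0 < r -> measurable A ->
  - K <= a -> a + r <= K ->
  window_measure K (A `&` `]a, a + r[%classic) = 0 -> `]a, a + r[%classic `<=` fattening A ->
  r + window_measure K A <= window_measure K (fattening A).
Proof.
move=> r0 mA Ka aK Aa aF; have mF := measurable_fattening r0 mA.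
have mI : measurable (`]a, a + r[%classic : set T) by exact: itv_leb_measurable.
rewrite (window_measure_split K mF mI).
have -> : fattening A `&` `]a, a + r[%classic = `]a, a + r[%classic by apply/setIidr.
rewrite window_measure_itv//; last by lra.
rewrite (_ : a + r - a = r); last by lra.
rewrite lerD2l (window_measure_split K mA mI) Aa add0r.
have mAI := measurableD mA mI.
rewrite (window_measure_split K mAI mF) -[leRHS]addr0 lerD//.
  apply: window_measure_le; [exact: measurableI|exact: measurableD|].
  by move=> x [[_ ?] ?].
rewrite -(window_measure_diff_fattening K r0 mA); apply: window_measure_le.
- exact: measurableD.
- exact: measurableD.
- by move=> x [[? _] ?].
Qed.

End fattening.

(** * Overlap of the fattenings of two opposite sets *)

Section fattening_overlap.
Context {R : realType}.
Notation mu := (@leb R).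
Notation T := (@leb_type R).
Implicit Types (A B : set T) (r K L M g : R).

Let mi (i : interval R) : measurable ([set` i] : set T) := itv_leb_measurable i.

Let leb_eq0_sub A B C : measurable B -> measurable C -> mu B = 0%E -> mu C = 0%E ->
  A `<=` B `|` C -> mu A = 0%E.
Proof.
move=> mB mC B0 C0 ABC; apply/eqP; rewrite eq_le measure_ge0 andbT.
by rewrite (le_trans (leb_le ABC))// (le_trans (leb_setU mB mC))// B0 C0 adde0.
Qed.

(** The number [inf S] is the essential infimum of [A]. A point less than [r] to its left has a
    window that reaches beyond it, so the interval of length [r] ending there is gained. *)
Lemma fattening_left_end A r K L M : 0 < r -> measurable A ->
  mu (A `&` `]-oo, - L[) = 0%E -> mu (A `&` `]-oo, M[) != 0%E ->
  exists a : R, [/\ - L - r <= a, a + r <= M, `]a, a + r[%classic `<=` fattening r A &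
    window_measure K (A `&` `]a, a + r[%classic) = 0].
Proof.
move=> r0 mA A0 A1; pose S : set R := [set x | mu (A `&` `]-oo, x[) != 0%E].
have mAi (i : interval R) : measurable (A `&` [set` i]) by exact: measurableI.
have lbS : lbound S (- L).
  move=> x /= /negP Sx; rewrite leNgt; apply/negP => xL; apply: Sx.
  apply/eqP/(leb_eq0_sub (mAi `]-oo, - L[) (mAi `]-oo, - L[)) => //.
  by move=> z [Az]; rewrite /= !in_itv/= => zx; left; split => //; rewrite /= ?in_itv/=; lra.
have hiS : has_inf S by split; [exists M|exists (- L)].
have below y : y < inf S -> mu (A `&` `]-oo, y[) = 0%E.
  move=> yS; apply: contrapT => /eqP Sy.
  by have := ge_inf (proj2 hiS) (Sy : S y); rewrite leNgt yS.
have above y : inf S < y -> mu (A `&` `]-oo, y[) != 0%E.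
  move=> yS; have [s Ss sy] := inf_lt (proj1 hiS) yS.
  apply: contra_neq Ss => Ay; apply: (leb_eq0_sub (mAi `]-oo, y[) (mAi `]-oo, y[)) => //.
  by move=> z [Az]; rewrite /= !in_itv/= => zs; left; split => //; rewrite /= ?in_itv/=; lra.
have infL : - L <= inf S by exact: (lb_le_inf (proj1 hiS) lbS).
have infM : inf S <= M by exact: (ge_inf (proj2 hiS) (A1 : S M)).
exists (inf S - r); rewrite subrK; split.
- lra.
- exact: infM.
- move=> x /=; rewrite in_itv/= => /andP[xa xb].
  have xa' : inf S < x + r by lra.
  apply: contra_neq (above _ xa') => Ax.
  apply: (leb_eq0_sub (mAi `]-oo, x[) (mAi `]x - r, x + r[)) => //; first exact: below.
  move=> z [Az]; rewrite /= in_itv/= => zx.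
  by case: (ltP z x) => zx'; [left|right]; split => //; rewrite /= ?in_itv/= ?zx'//; lra.
- apply: window_measure_eq0 => //; apply/eqP; rewrite eq_le measure_ge0 andbT.
  apply/lee_addgt0Pr => e e0; rewrite add0e.
  apply: (@le_trans _ _ (mu ((A `&` `]-oo, inf S - e[) `|` `[inf S - e, inf S[))).
    apply: leb_le => z /= [Az]; rewrite in_itv/= => /andP[za zb].
    case: (ltP z (inf S - e)) => ze; [left|right]; rewrite ?in_itv/= ?ze//; lra.
  apply: (le_trans (leb_setU _ _)) => //.
  rewrite below; last by lra.
  by rewrite add0e leb_itv /= lte_fin; case: ifP => _; rewrite -?EFinB lee_fin; lra.
Qed.

(** Mirror image of [fattening_left_end]: [sup S] is the essential supremum of [B], and the gained
    interval lies to its right. *)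
Lemma fattening_right_end B r K L M : 0 < r -> measurable B ->
  mu (B `&` `]L, +oo[) = 0%E -> mu (B `&` `]M, +oo[) != 0%E ->
  exists a : R, [/\ M <= a, a <= L, `]a, a + r[%classic `<=` fattening r B &
    window_measure K (B `&` `]a, a + r[%classic) = 0].
Proof.
move=> r0 mB B0 B1; pose S : set R := [set x | mu (B `&` `]x, +oo[) != 0%E].
have mBi (i : interval R) : measurable (B `&` [set` i]) by exact: measurableI.
have ubS : ubound S L.
  move=> x /= /negP Sx; rewrite leNgt; apply/negP => xL; apply: Sx.
  apply/eqP/(leb_eq0_sub (mBi `]L, +oo[) (mBi `]L, +oo[)) => //.
  move=> z [Bz]; rewrite /= !in_itv/= !andbT => zx; left; split => //.
  by rewrite /= ?in_itv/= ?andbT; lra.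
have hsS : has_sup S by split; [exists M|exists L].
have above y : sup S < y -> mu (B `&` `]y, +oo[) = 0%E.
  move=> yS; apply: contrapT => /eqP Sy.
  by have := ub_le_sup (proj2 hsS) (Sy : S y); rewrite leNgt yS.
have below y : y < sup S -> mu (B `&` `]y, +oo[) != 0%E.
  move=> yS; have [s Ss sy] := sup_gt (proj1 hsS) yS.
  apply: contra_neq Ss => Ay; apply: (leb_eq0_sub (mBi `]y, +oo[) (mBi `]y, +oo[)) => //.
  move=> z [Bz]; rewrite /= !in_itv/= !andbT => zs; left; split => //.
  by rewrite /= ?in_itv/= ?andbT; lra.
have supL : sup S <= L by exact: (ge_sup (proj1 hsS) ubS).
have supM : M <= sup S by exact: (ub_le_sup (proj2 hsS) (B1 : S M)).
exists (sup S); split => //.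
- move=> x /=; rewrite in_itv/= => /andP[xa xb].
  have xa' : x - r < sup S by lra.
  apply: contra_neq (below _ xa') => Bx.
  apply: (leb_eq0_sub (mBi `]x, +oo[) (mBi `]x - r, x + r[)) => //; first exact: above.
  move=> z [Bz]; rewrite /= in_itv/= andbT => zx.
  by case: (ltP x z) => zx'; [left|right]; split => //; rewrite /= ?in_itv/= ?zx'//; lra.
- apply: window_measure_eq0 => //; apply/eqP; rewrite eq_le measure_ge0 andbT.
  apply/lee_addgt0Pr => e e0; rewrite add0e.
  apply: (@le_trans _ _ (mu ((B `&` `]sup S + e, +oo[) `|` `]sup S, sup S + e]))).
    apply: leb_le => z /= [Bz]; rewrite in_itv/= => /andP[za zb].
    case: (ltP (sup S + e) z) => ze; [left|right]; rewrite ?in_itv/= ?ze ?za//; lra.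
  apply: (le_trans (leb_setU _ _)) => //.
  rewrite above; last by lra.
  by rewrite add0e leb_itv /= lte_fin; case: ifP => _; rewrite -?EFinB lee_fin; lra.
Qed.

(* Each fattened set gains an interval of length [r] at its free end; since both
   fit in the window, inclusion-exclusion bounds the overlap from below. *)
Lemma fattening_overlap A B r L g : 0 < r -> measurable A -> measurable B ->
  A `&` B = set0 ->
  mu (~` A `&` `]L, +oo[) = 0%E -> mu (~` B `&` `]-oo, - L[) = 0%E ->
  (mu (~` (A `|` B)) <= g%:E)%E ->
  ((2 * r - g)%:E <= mu (fattening r A `&` fattening r B))%E.
Proof.
move=> r0 mA mB AB0 hA hB hg.
have mAi (i : interval R) : measurable (A `&` [set` i]) by exact: measurableI.
have mBi (i : interval R) : measurable (B `&` [set` i]) by exact: measurableI.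
have mCA := measurableC mA; have mCB := measurableC mB.
have mCAi (i : interval R) : measurable (~` A `&` [set` i]) by exact: measurableI.
have mCBi (i : interval R) : measurable (~` B `&` [set` i]) by exact: measurableI.
have notAB x : A x -> ~ B x by move=> Ax Bx; have : (A `&` B) x by []; rewrite AB0.
(* The two gained intervals start between [- L - r] and [L + 1 - r], and between [- L - 1] and [L];
   this window contains both. *)
pose K : R := `|L| + 1 + r.
have LK : L <= `|L| by exact: ler_norm.
have LK' : - L <= `|L| by rewrite -normrN; exact: ler_norm.
have A0 : mu (A `&` `]-oo, - L[) = 0%E.
  apply: (leb_eq0_sub (mCBi `]-oo, - L[) (mCBi `]-oo, - L[)) => //.
  by move=> x [Ax Lx]; left; split => //; exact: notAB.
have B0 : mu (B `&` `]L, +oo[) = 0%E.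
  apply: (leb_eq0_sub (mCAi `]L, +oo[) (mCAi `]L, +oo[)) => //.
  by move=> x [Bx Lx]; left; split => // /notAB.
have A1 : mu (A `&` `]-oo, L + 1[) != 0%E.
  apply/negP => /eqP A1.
  have : mu `]L, L + 1[%classic = 0%E.
    apply: (leb_eq0_sub (mCAi `]L, +oo[) (mAi `]-oo, L + 1[)) => //.
    move=> x; rewrite /= in_itv/= => /andP[xa xb].
    by have [Ax|Ax] := pselect (A x); [right|left]; split => //; rewrite /= ?in_itv/= ?xa.
  rewrite leb_itv /= lte_fin ltrDl ltr01 -EFinB => /eqP.
  by rewrite eqe; apply/negP; rewrite (_ : L + 1 - L = 1) ?oner_eq0//; lra.
have B1 : mu (B `&` `]- L - 1, +oo[) != 0%E.
  apply/negP => /eqP B1.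
  have : mu `]- L - 1, - L[%classic = 0%E.
    apply: (leb_eq0_sub (mCBi `]-oo, - L[) (mBi `]- L - 1, +oo[)) => //.
    move=> x; rewrite /= in_itv/= => /andP[xa xb].
    by have [Bx|Bx] := pselect (B x); [right|left]; split => //; rewrite /= ?in_itv/= ?xa ?xb.
  rewrite leb_itv /= lte_fin ltrBlDr ltrDl ltr01 -EFinB => /eqP.
  by rewrite eqe; apply/negP; rewrite (_ : - L - (- L - 1) = 1) ?oner_eq0//; lra.
have [a [a1 a2 aF aA]] := fattening_left_end K r0 mA A0 A1.
have [b [b1 b2 bF bB]] := fattening_right_end K r0 mB B0 B1.
have hFA : r + window_measure K A <= window_measure K (fattening r A).
  by apply: (window_measure_fattening_ge r0 mA _ _ aA aF); rewrite /K; lra.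
have hFB : r + window_measure K B <= window_measure K (fattening r B).
  by apply: (window_measure_fattening_ge r0 mB _ _ bB bF); rewrite /K; lra.
have mFA := measurable_fattening r0 mA; have mFB := measurable_fattening r0 mB.
have mFAB := measurableI _ _ mFA mFB.
have K0 : 0 <= K by rewrite /K; have := normr_ge0 L; lra.
have mT : measurable (setT : set T) by [].
have splitF : window_measure K (fattening r A) + window_measure K (fattening r B)
    <= 2 * K + window_measure K (fattening r A `&` fattening r B).
  rewrite -(window_measureT K0) (window_measure_split K mT mFB) !setTI.
  rewrite (window_measure_split K mFA mFB).
  have : window_measure K (fattening r A `\` fattening r B) <=
      window_measure K (setT `\` fattening r B).
    apply: window_measure_le; [exact: measurableD|exact: measurableD|].
    by move=> x [].
  lra.
have splitT : 2 * K <= window_measure K A + window_measure K B + g.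
  have mD := measurableD mT mA.
  rewrite -(window_measureT K0) (window_measure_split K mT mA) setTI.
  rewrite (window_measure_split K mD mB) -addrA lerD2l.
  apply: lerD.
    by apply: window_measure_le => //; exact: measurableI.
  rewrite -lee_fin; apply: le_trans hg.
  apply: (le_trans (window_measure_le_leb K _)); first exact: measurableD.
  by apply: leb_le => x [[_ ?] ?] [].
rewrite (le_trans _ (window_measure_le_leb K mFAB))// lee_fin.
move: hFA hFB splitF splitT; lra.
Qed.

End fattening_overlap.

(** * Integrals of nonnegative functions *)

Section nonnegative_integral.
Context d (T : measurableType d) {R : realType}.
Variable mu : {measure set T -> \bar R}.
Implicit Types (f g : T -> R) (A B : set T).

Definition nnint f : \bar R := (\int[mu]_x (f x)%:E)%E.

Definition nn_mfun f := (forall x, 0 <= f x) /\ measurable_fun setT f.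

Lemma nnint_ge0 f : (forall x, 0 <= f x) -> (0 <= nnint f)%E.
Proof. by move=> f0; apply: integral_ge0 => x _; rewrite lee_fin. Qed.

Lemma nnint_le f g : nn_mfun f -> nn_mfun g -> (forall x, f x <= g x) ->
  (nnint f <= nnint g)%E.
Proof.
move=> [f0 mf] [g0 mg] fg; apply: ge0_le_integral => //.
- by move=> x _; rewrite lee_fin.
- exact/measurable_EFinP.
- exact/measurable_EFinP.
- by move=> x _; rewrite lee_fin.
Qed.

Lemma nnint_ae_le f g A : nn_mfun f -> nn_mfun g -> measurable A -> mu A = 0%E ->
  (forall x, ~ A x -> f x <= g x) -> (nnint f <= nnint g)%E.
Proof.
move=> [f0 mf] [g0 mg] mA A0 fg; apply: ae_ge0_le_integral => //.
- by move=> x _; rewrite lee_fin.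
- exact/measurable_EFinP.
- by move=> x _; rewrite lee_fin.
- exact/measurable_EFinP.
- exists A; split => //.
  by move=> x /=; apply: contra_notP => /fg; rewrite lee_fin.
Qed.

Lemma nnint_ae_eq f g A : nn_mfun f -> nn_mfun g -> measurable A -> mu A = 0%E ->
  (forall x, ~ A x -> f x = g x) -> nnint f = nnint g.
Proof.
move=> nf ng mA A0 fg; apply/eqP; rewrite eq_le.
by apply/andP; split; apply: (nnint_ae_le _ _ mA A0) => // x /fg ->.
Qed.

Lemma nnint_add f g : nn_mfun f -> nn_mfun g ->
  nnint (fun x => f x + g x) = (nnint f + nnint g)%E.
Proof.
move=> [f0 mf] [g0 mg]; rewrite /nnint -ge0_integralD//.
- by move=> x _; rewrite lee_fin.
- exact/measurable_EFinP.
- by move=> x _; rewrite lee_fin.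
- exact/measurable_EFinP.
Qed.

Lemma nnint_scale f (c : R) : nn_mfun f -> 0 <= c ->
  nnint (fun x => c * f x) = (c%:E * nnint f)%E.
Proof.
move=> [f0 mf] c0; rewrite /nnint -ge0_integralZl_EFin//.
- by move=> x _; rewrite lee_fin.
- exact/measurable_EFinP.
Qed.

Lemma nnint_indic A : measurable A -> nnint \1_A = mu A.
Proof. by move=> mA; rewrite /nnint integral_indic// setIT. Qed.

Lemma nn_mfun_indic A : measurable A -> nn_mfun \1_A.
Proof. by move=> mA; split => // x; rewrite indicE. Qed.

Lemma nn_mfun_add f g : nn_mfun f -> nn_mfun g -> nn_mfun (fun x => f x + g x).
Proof. by move=> [? ?] [? ?]; split; [move=> x; exact: addr_ge0|exact: measurable_funD]. Qed.

Lemma nn_mfun_mul f g : nn_mfun f -> nn_mfun g -> nn_mfun (fun x => f x * g x).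
Proof. by move=> [? ?] [? ?]; split; [move=> x; exact: mulr_ge0|exact: measurable_funM]. Qed.

Lemma nn_mfun_cst (c : R) : 0 <= c -> nn_mfun (fun=> c).
Proof. by move=> c0; split. Qed.

Lemma nn_mfun_scale f (c : R) : nn_mfun f -> 0 <= c -> nn_mfun (fun x => c * f x).
Proof. by move=> nf c0; apply: nn_mfun_mul => //; exact: nn_mfun_cst. Qed.

Lemma nn_mfun_sum (I : Type) (s : seq I) (F : I -> T -> R) :
  (forall i, nn_mfun (F i)) -> nn_mfun (fun x => \sum_(i <- s) F i x).
Proof.
move=> nF; elim: s => [|i s IH].
  by under eq_fun do rewrite big_nil; exact: nn_mfun_cst.
by under eq_fun do rewrite big_cons; exact: nn_mfun_add.
Qed.

Lemma nnint_sum (I : Type) (s : seq I) (F : I -> T -> R) :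
  (forall i, nn_mfun (F i)) ->
  nnint (fun x => \sum_(i <- s) F i x) = (\sum_(i <- s) nnint (F i))%E.
Proof.
move=> nF; elim: s => [|i s IH].
  rewrite big_nil; under eq_fun do rewrite big_nil.
  by apply: integral0_eq.
rewrite big_cons; under eq_fun do rewrite big_cons.
by rewrite nnint_add ?IH//; exact: nn_mfun_sum.
Qed.

Lemma nnint_sum_indic (I : Type) (s : seq I) (c : I -> R) (E : I -> set T) :
  (forall i, 0 <= c i) -> (forall i, measurable (E i)) ->
  nnint (fun x => \sum_(i <- s) c i * \1_(E i) x) =
  (\sum_(i <- s) (c i)%:E * mu (E i))%E.
Proof.
move=> c0 mE; rewrite nnint_sum; last first.
  by move=> i; apply: nn_mfun_scale => //; exact: nn_mfun_indic.
apply: eq_bigr => i _; rewrite nnint_scale ?nnint_indic//.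
Qed.

Lemma nnint_fatou (F : nat -> T -> R) f (c : nat -> R) (l : R) A :
  (forall n, nn_mfun (F n)) -> nn_mfun f -> measurable A -> mu A = 0%E ->
  (forall x, ~ A x -> F ^~ x @ \oo --> f x) ->
  (forall n, (nnint (F n) <= (c n)%:E)%E) -> c @ \oo --> l ->
  (nnint f <= l%:E)%E.
Proof.
move=> nF nf mA A0 fF Fc cl.
have mF n : measurable_fun setT (fun x => (F n x)%:E).
  by apply/measurable_EFinP; exact: (nF n).2.
have F0 n x : setT x -> (0 <= (F n x)%:E)%E by move=> _; rewrite lee_fin; exact: (nF n).1.
have limF x : ~ A x -> limn_einf (fun n => (F n x)%:E) = (f x)%:E.
  move=> /fF Fx; have FxE : (fun n => (F n x)%:E) @ \oo --> (f x)%:E by apply: cvg_EFin => //; exact: nearW.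
  have cv : cvgn (fun n => (F n x)%:E) by apply/cvg_ex; exists (f x)%:E.
  by rewrite (is_cvg_limn_einfE cv); exact: cvg_lim.
have mL : measurable_fun setT (fun x => limn_einf (fun n => (F n x)%:E)).
  apply: measurableT_comp => //.
  by apply: measurable_fun_limn_esup => n; exact: measurableT_comp.
have h := fatou mu measurableT mF F0.
apply: (@le_trans _ _ (limn_einf (fun n => nnint (F n)))); last first.
  have cE : (fun n => (c n)%:E) @ \oo --> l%:E by apply: cvg_EFin => //; exact: nearW.
  rewrite limn_einf_lim -(cvg_lim _ cE)//; apply: lee_lim.
  - exact: is_cvg_einfs.
  - by apply/cvg_ex; exists l%:E.
  - apply: nearW => n; apply: le_trans (Fc n).
    by apply: ereal_inf_lbound; exists n => //=.
apply: le_trans h; rewrite le_eqVlt; apply/orP; left; apply/eqP.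
apply: ae_eq_integral => //.
- by apply/measurable_EFinP; exact: nf.2.
- by exists A; split => // x /=; apply: contra_notP => /limF -> _.
Qed.

End nonnegative_integral.

(** * Step functions *)

Section prefix_counting.
Implicit Types (P Q : nat -> bool) (n : nat).

(** Truth on an initial segment of the indices, as for [l i <= x] with nondecreasing [l]; counting
    then yields the index of the level reached. *)
Definition prefix_closed n P := forall i j, (i <= j)%N -> (j < n)%N -> P j -> P i.

Definition prefix_count n P := (\sum_(j < n) P j)%N.

Lemma prefix_count_le n P : (prefix_count n P <= n)%N.
Proof.
rewrite -[X in (_ <= X)%N]card_ord -sum1_card; apply: leq_sum => i _.
by case: (P i).
Qed.

Lemma prefix_countE n P i : prefix_closed n P -> (i < n)%N ->
  P i = (i < prefix_count n P)%N.
Proof.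
elim: n i => // n IH i Pn; rewrite ltnS => ile; rewrite /prefix_count big_ord_recr /=.
case PnE : (P n).
  have allP j : (j <= n)%N -> P j by move=> jn; exact: (Pn j n).
  rewrite (eq_bigr (fun=> 1%N)) ?sum1_card ?card_ord ?addn1 ?ltnS ?ile ?allP//.
  by move=> j _; rewrite allP//; exact: ltnW.
have Pn' : prefix_closed n P by move=> a b ab bn; apply: Pn => //; exact: ltnW.
rewrite addn0; move: ile; rewrite leq_eqVlt => /predU1P[->|iln]; last exact: IH.
by rewrite PnE; apply/esym/negbTE; rewrite -leqNgt; exact: prefix_count_le.
Qed.

Lemma prefix_count_diff n P Q : prefix_closed n P -> prefix_closed n Q ->
  (\sum_(i < n) (P i && ~~ Q i) = prefix_count n P - prefix_count n Q)%N.
Proof.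
move=> cP cQ; have [PQ|/ltnW QP] := leqP (prefix_count n P) (prefix_count n Q).
  rewrite big1 => [|i _]; first by apply/esym/eqP; rewrite subn_eq0.
  rewrite (prefix_countE cP)// (prefix_countE cQ)//.
  by have [/leq_trans/(_ PQ) ->|] := ltnP i (prefix_count n P).
apply/eqP; rewrite -(eqn_add2r (prefix_count n Q)) subnK// -big_split /=.
apply/eqP/eq_bigr => i _; rewrite (prefix_countE cP)// (prefix_countE cQ)//.
by have [/leq_trans/(_ QP) ->|] := ltnP i (prefix_count n Q); rewrite ?andbT ?addn0.
Qed.

(** At most one summand survives, the one where the initial segment ends; there is none if the
    segment is empty or exhausts all indices. *)
Lemma prefix_jump_sum (R : realType) n P (a : nat -> R) : prefix_closed n P ->
  \sum_(k < n.-1) a k * (P k && ~~ P k.+1)%:R =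
  if (0 < prefix_count n P < n)%N then a (prefix_count n P).-1 else 0.
Proof.
move=> cP.
have PE (k : 'I_n.-1) : P k && ~~ P k.+1 = (k.+1 == prefix_count n P).
  case: n k cP => [|n] k cP; first by case: k.
  have kn : (k < n)%N by exact: ltn_ord.
  rewrite (prefix_countE cP (leqW kn)) (prefix_countE (i := k.+1) cP)//.
  by rewrite -leqNgt -eqn_leq eq_sym.
set c := prefix_count n P in PE *.
under eq_bigr do rewrite PE.
case: ifPn => [/andP[c0 cn]|h].
  have c1 : (c.-1 < n.-1)%N by rewrite -ltnS !prednK// (leq_ltn_trans _ cn).
  rewrite (bigD1 (Ordinal c1))//= prednK// eqxx mulr1 big1 ?addr0// => k kc.
  case: eqP => // kE; last by rewrite mulr0.
  by exfalso; move/negP: kc; apply; apply/eqP/val_inj; rewrite /= -kE.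
rewrite big1// => k _; case: eqP => [kE|_]; last by rewrite mulr0.
exfalso; move/negP: h; apply; rewrite -kE /=.
by case: n {c cP PE kE} k => [|n] k; [case: k|rewrite ltnS].
Qed.

End prefix_counting.

Section indicator_sums.
Context d (T : measurableType d) {R : realType}.
Variable mu : {measure set T -> \bar R}.

Lemma nn_mfun_sum_indic n (S : 'I_n -> set T) (h : R) : 0 <= h ->
  (forall i, measurable (S i)) -> nn_mfun (fun x => (h * \sum_(i < n) \1_(S i) x) ^+ 2).
Proof.
move=> h0 mS; apply: nn_mfun_mul; apply: nn_mfun_scale => //;
  by apply: nn_mfun_sum => i; exact: nn_mfun_indic.
Qed.

Lemma nnint_sqr_sum_indic n (S : 'I_n -> set T) (h : R) : 0 <= h ->
  (forall i, measurable (S i)) ->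
  nnint mu (fun x => (h * \sum_(i < n) \1_(S i) x) ^+ 2) =
  (\sum_(p : 'I_n * 'I_n) (h ^+ 2)%:E * mu (S p.1 `&` S p.2))%E.
Proof.
move=> h0 mS; rewrite -nnint_sum_indic; last 2 first.
- by move=> _; exact: sqr_ge0.
- by move=> p; exact: measurableI.
congr (nnint mu _); apply/funext => x; rewrite exprMn [X in _ * X]expr2 big_distrlr /= pair_big /=.
by rewrite big_distrr /=; apply: eq_bigr => p _; rewrite indicI.
Qed.

Lemma nnint_sqr_sum_indic_le n (S S' : 'I_n -> set T) (h : R) : 0 <= h ->
  (forall i, measurable (S i)) -> (forall i, measurable (S' i)) ->
  (forall i j : 'I_n, (i <= j)%N -> mu (S i `&` S j) <= mu (S' i `&` S' j))%E ->
  (nnint mu (fun x => (h * \sum_(i < n) \1_(S i) x) ^+ 2)%R <=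
   nnint mu (fun x => (h * \sum_(i < n) \1_(S' i) x) ^+ 2)%R)%E.
Proof.
move=> h0 mS mS' SS'; rewrite !nnint_sqr_sum_indic//; apply: lee_sum => -[i j] _ /=.
apply: lee_wpmul2l; first by rewrite lee_fin sqr_ge0.
case: (leqP i j) => [ij|/ltnW ji]; first exact: SS'.
by rewrite setIC (setIC (S' i)); exact: SS'.
Qed.

End indicator_sums.

Section step_functions.
Context {R : realType}.
Implicit Types (W w : R -> R) (l : nat -> R).

Record double_well W : Prop := {
  dw_continuous : continuous W;
  dw_ge0 : forall t, 0 <= W t;
  dw_gt0 : forall t, t != -1 -> t != 1 -> 0 < W t;
  dw_m1 : W (-1) = 0;
  dw_1 : W 1 = 0;
  dw_decr : forall s t, 0 <= s -> s <= t -> t <= 1 -> W t <= W s;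
  dw_incr : forall s t, -1 <= s -> s <= t -> t <= 0 -> W s <= W t }.

(** The sign conditions break the translation invariance, which would let a minimizing sequence
    drift towards a constant. Limits at infinity are not imposed, since pointwise limits need not
    preserve them. *)
Record admissible w : Prop := {
  adm_homo : forall x y, x <= y -> w x <= w y;
  adm_bound : forall x, -1 <= w x <= 1;
  adm_neg : forall x, x < 0 -> w x <= 0;
  adm_pos : forall x, 0 <= x -> 0 <= w x }.

(** Used in two ways: with jump positions [l] it is a staircase in the space variable, and with
    thresholds [l] it is the rounding map applied to values. *)
Definition step_fun n (h : R) l (x : R) : R :=
  -1 + h * (prefix_count n (fun i => l i <= x))%:R.

Definition nondecreasing_below n l :=
  forall i j, (i <= j)%N -> (j < n)%N -> l i <= l j.

Lemma prefix_closed_le n l x : nondecreasing_below n l ->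
  prefix_closed n (fun i => l i <= x).
Proof. by move=> lm i j ij jn; apply: le_trans; exact: lm. Qed.

Lemma step_fun_bound n (h : R) l x : 0 <= h -> h * n%:R = 2 -> -1 <= step_fun n h l x <= 1.
Proof.
move=> h0 hn; rewrite /step_fun; set c := prefix_count _ _.
have : h * c%:R <= h * n%:R by rewrite ler_wpM2l// ler_nat; exact: prefix_count_le.
have : 0 <= h * c%:R by exact: mulr_ge0.
by rewrite hn => ? ?; apply/andP; split; lra.
Qed.

Lemma step_fun_homo n (h : R) l x y : 0 <= h -> x <= y -> step_fun n h l x <= step_fun n h l y.
Proof.
move=> h0 xy; rewrite lerD2l ler_wpM2l// ler_nat; apply: leq_sum => i _.
by case: (boolP (l i <= x)) => // /le_trans/(_ xy) ->.
Qed.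

(** Level number [N] has the value [0]: for [x < 0] at most [N] jumps have been passed, because
    [l N] is not among them, and for [0 <= x] at least [N], because [l N.-1] is. *)
Lemma step_fun_admissible N (h : R) l : (0 < N)%N -> h * N%:R = 1 ->
  nondecreasing_below (N + N) l -> l N.-1 <= 0 -> 0 <= l N ->
  admissible (step_fun (N + N) h l).
Proof.
move=> N0 hN lm lN1 lN.
have Np : 0 < N%:R :> R by rewrite ltr0n.
have h0 : 0 <= h by rewrite -(pmulr_lge0 _ Np) hN.
have hn : h * (N + N)%:R = 2 by rewrite natrD mulrDr hN; lra.
split => [x y|x|x x0|x x0].
- exact: step_fun_homo.
- exact: step_fun_bound.
- have NN : (N < N + N)%N by rewrite -[X in (X < _)%N]addn0 ltn_add2l.
  have := prefix_countE (prefix_closed_le (x := x) lm) NN.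
  have -> : (l N <= x) = false by apply/negbTE; rewrite -ltNge; lra.
  move/esym/negbT; rewrite -leqNgt => cN.
  rewrite /step_fun addrC subr_le0 -[leRHS]hN ler_wpM2l// ler_nat.
  exact: cN.
- have NN : (N.-1 < N + N)%N by rewrite prednK// leq_addr.
  have := prefix_countE (prefix_closed_le (x := x) lm) NN.
  have -> : (l N.-1 <= x) = true by apply: le_trans x0.
  move/esym; rewrite prednK// => cN.
  by rewrite /step_fun addrC subr_ge0 -[leLHS]hN ler_wpM2l// ler_nat.
Qed.

Lemma step_fun_increment n (h r : R) l (x : leb_type) : 0 < r ->
  step_fun n h l (x + r) - step_fun n h l (x - r) =
  h * \sum_(i < n) \1_(`[l i - r, l i + r[%classic : set leb_type) x.
Proof.
move=> r0; rewrite /step_fun /prefix_count !natr_sum.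
rewrite opprD addrACA subrr add0r -mulrBr -sumrB; congr (h * _).
apply: eq_bigr => i _; rewrite indicE.
rewrite (_ : (x \in _) = (l i <= x + r) && (x - r < l i)); last first.
  apply/idP/idP; first by rewrite inE /= in_itv/= => /andP[? ?]; apply/andP; split; lra.
  by move=> /andP[? ?]; rewrite inE /= in_itv/=; apply/andP; split; lra.
case: (leP (l i) (x - r)) => h1; case: (leP (l i) (x + r)) => h2 //=;
  rewrite ?subr0 ?subrr//; lra.
Qed.

Lemma step_fun_well n (h : R) l W (x : leb_type) : nondecreasing_below n l ->
  W (-1) = 0 -> W 1 = 0 -> h * n%:R = 2 ->
  W (step_fun n h l x) =
  \sum_(k < n.-1) W (-1 + h * k.+1%:R) * \1_(`[l k, l k.+1[%classic : set leb_type) x.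
Proof.
move=> lm W1 W2 hn.
have cP := prefix_closed_le (x := x) lm.
transitivity (\sum_(k < n.-1) W (-1 + h * k.+1%:R) *
    ((l k <= x) && ~~ (l k.+1 <= x))%:R); last first.
  apply: eq_bigr => k _; rewrite indicE; congr (_ * (nat_of_bool _)%:R).
  by rewrite -ltNge; apply/idP/idP; rewrite inE /= in_itv.
rewrite (prefix_jump_sum (fun k => W (-1 + h * k.+1%:R)) cP) /step_fun.
set c := prefix_count _ _; have cn : (c <= n)%N by exact: prefix_count_le.
case: (posnP c) => [->|c0] /=; first by rewrite mulr0 addr0.
move: cn; rewrite leq_eqVlt => /predU1P[->|cn]; last by rewrite cn prednK.
by rewrite ltnn hn (_ : -1 + 2 = 1) //; lra.
Qed.

End step_functions.

(** * Rounding of values *)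

Section thresholds.
Context {R : realType}.
Variables (N : nat) (h kappa : R).

(* The [i]-th threshold lies on the inner side of the level reached by crossing it,
   so that rounding moves values away from [0] and lowers the potential. *)
Definition threshold (i : nat) : R := kappa * (-1 + h * (i + (i < N))%:R).

(** The [- 1] covers the case [i < N <= j]: the thresholds [N.-1] and [N] coincide, so one step is
    lost across the middle. *)
Lemma threshold_diff i j : 0 <= kappa -> 0 <= h -> (i <= j)%N ->
  kappa * (h * (j%:R - i%:R - 1)) <= threshold j - threshold i.
Proof.
move=> k0 h0 ij; rewrite /threshold -mulrBr ler_wpM2l// opprD addrACA subrr add0r.
rewrite -mulrBr ler_wpM2l// !natrD.
by case: (i < N)%N; case: (j < N)%N => /=; lra.
Qed.

Lemma threshold_homo n : 0 <= kappa -> 0 <= h -> nondecreasing_below n threshold.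
Proof.
move=> k0 h0 i j ij _; rewrite ler_wpM2l// lerD2l ler_wpM2l// ler_nat.
move: ij; rewrite leq_eqVlt => /predU1P[->//|ij].
by case: (i < N)%N; rewrite ?addn1 ?addn0; [rewrite (leq_trans ij)// leq_addr|rewrite (leq_trans (ltnW ij))// leq_addr].
Qed.

Lemma threshold_bound i : 0 < kappa -> (0 < N)%N -> h * N%:R = 1 -> (i < N + N)%N ->
  - kappa < threshold i < kappa.
Proof.
move=> k0 N0 hN iN.
have Np : 0 < N%:R :> R by rewrite ltr0n.
have h0 : 0 < h by rewrite -(pmulr_lgt0 _ Np) hN.
have hn : h * (N + N)%:R = 2 by rewrite natrD mulrDr hN; lra.
have i1 : (0 < i + (i < N))%N.
  by case: i {iN} => [|i]; rewrite ?N0.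
have i2 : (i + (i < N) < N + N)%N.
  have [iN'|_] := ltnP i N; last by rewrite addn0.
  by rewrite /= addn1 (leq_ltn_trans iN')// -[X in (X < _)%N]addn0 ltn_add2l.
have m0 : 0 < kappa * (h * (i + (i < N))%:R) by rewrite !mulr_gt0// ltr0n.
have m2 : kappa * (h * (i + (i < N))%:R) < kappa * 2.
  by rewrite ltr_pM2l// -hn ltr_pM2l// ltr_nat.
by rewrite /threshold mulrDr mulrN1; apply/andP; split; lra.
Qed.

Lemma threshold_well W y : double_well W -> 0 < kappa <= 1 -> (0 < N)%N -> h * N%:R = 1 ->
  W (step_fun (N + N) h threshold y) <= W y.
Proof.
move=> dW /andP[k0 k1] N0 hN.
have Np : 0 < N%:R :> R by rewrite ltr0n.
have h0 : 0 < h by rewrite -(pmulr_lgt0 _ Np) hN.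
have hn : h * (N + N)%:R = 2 by rewrite natrD mulrDr hN; lra.
have cP := prefix_closed_le (x := y) (threshold_homo (n := N + N) (ltW k0) (ltW h0)).
rewrite /step_fun; set c := prefix_count _ _ in cP *.
have cn : (c <= N + N)%N by exact: prefix_count_le.
case: (posnP c) => [->|c0] /=; first by rewrite mulr0 addr0 (dw_m1 dW); exact: (dw_ge0 dW).
move: cn; rewrite leq_eqVlt => /predU1P[->|cn].
  by rewrite hn (_ : -1 + 2 = 1) ?(dw_1 dW); [exact: (dw_ge0 dW)|lra].
have lo : threshold c.-1 <= y.
  by rewrite (prefix_countE cP) ?prednK//; exact: ltnW.
have hi : y < threshold c.
  by rewrite ltNge (prefix_countE cP)// -/c ltnn.
have hc : h * c%:R <= 2 by rewrite -hn ler_wpM2l ?(ltW h0)// ler_nat; exact: ltnW.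
have [Nc|cN|cN] := ltngtP N c.
- have hNc : 1 <= h * c.-1%:R.
    by rewrite -[leLHS]hN ler_wpM2l ?(ltW h0)// ler_nat -ltnS prednK.
  have y0 : 0 <= y.
    apply: le_trans lo; rewrite /threshold mulr_ge0 ?(ltW k0)//.
    by rewrite ltnNge -ltnS prednK// Nc /= addn0; lra.
  apply: dw_decr => //; last by lra.
  apply: (le_trans (ltW hi)); rewrite /threshold ltnNge (ltnW Nc) addn0.
  have : h * c.-1%:R <= h * c%:R by rewrite ler_wpM2l ?(ltW h0)// ler_nat leq_pred.
  move=> cc; rewrite -subr_ge0.
  rewrite (_ : _ - _ = (1 - kappa) * (h * c%:R - 1)); last by ring.
  by rewrite mulr_ge0//; lra.
- have cN1 : h * c.+1%:R <= 1 by rewrite -[leRHS]hN ler_wpM2l ?(ltW h0)// ler_nat.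
  have cc : h * c%:R <= h * c.+1%:R by rewrite ler_wpM2l ?(ltW h0)// ler_nat.
  have c0' : 0 <= h * c%:R by rewrite mulr_ge0 ?(ltW h0).
  apply: dw_incr => //; first by lra.
    apply: le_trans lo; rewrite /threshold (_ : c.-1 < N)%N; last first.
      by rewrite prednK// ltnW.
    rewrite addn1 prednK//; rewrite -subr_ge0.
    rewrite (_ : _ - _ = (1 - kappa) * (1 - h * c%:R)); last by ring.
    by rewrite mulr_ge0//; lra.
  apply: (le_trans (ltW hi)); rewrite /threshold cN addn1.
  by rewrite pmulr_rle0//; lra.
(* The thresholds [N.-1] and [N] are both [0], so no value is rounded to the middle level. *)
- exfalso; move: lo hi; rewrite /threshold -cN ltnn addn0 prednK// leqnn addn1 prednK//.
  lra.
Qed.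

End thresholds.

(** * Comparison with a monotone step function *)

Section comparison.
Context {R : realType}.
Notation mu := (@leb R).
Notation T := (@leb_type R).
Implicit Types (v o : T -> R) (A B : set T).

Lemma fattening_sub (r : R) A B : A `<=` B -> fattening r A `<=` fattening r B.
Proof.
move=> AB x; apply: contra_neq => B0; apply/eqP; rewrite eq_le measure_ge0 andbT.
by rewrite -B0; apply: leb_le; exact: setSI.
Qed.

(** The crossed indices are those from [b] to [a - 1], by closure of both predicates under smaller
    indices. The extreme crossed thresholds differ by at most [o x], so [a - 1 - b] steps are
    controlled up to the step lost in the middle; together with the step from [a - 1] to [a] this
    gives [2 * h]. *)
Lemma crossing_count_le n (r h k : R) (t : nat -> R) v o (x : R) :
  0 < k -> 0 <= h -> nondecreasing_below n t ->
  (forall i j, (i <= j)%N -> (j < n)%N -> k * (h * (j%:R - i%:R - 1)) <= t j - t i) ->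
  0 <= o x ->
  (forall s1 s2 : R, fattening r [set y | s2 <= v y] x ->
    fattening r [set y | v y < s1] x -> s2 - s1 <= o x) ->
  h * \sum_(i < n) \1_(fattening r [set y | t i <= v y] `&`
                       fattening r [set y | v y < t i]) x <= k^-1 * o x + 2 * h.
Proof.
move=> k0 h0 tm td o0 ho.
pose P i := `[< fattening r [set y | t i <= v y] x >].
pose Q i := ~~ `[< fattening r [set y | v y < t i] x >].
have cP : prefix_closed n P.
  move=> i j ij jn /asboolP Pj; apply/asboolP; apply: fattening_sub Pj => y /=.
  by apply: le_trans; exact: tm.
have cQ : prefix_closed n Q.
  move=> i j ij jn; apply: contra => /asboolP Qi; apply/asboolP.
  by apply: fattening_sub Qi => y /= /lt_le_trans; apply; exact: tm.
rewrite (eq_bigr (fun i : 'I_n => (P i && ~~ Q i)%:R)); last first.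
  move=> i _; rewrite indicE; congr ((nat_of_bool _)%:R).
  rewrite /P /Q negbK; apply/idP/idP.
    by rewrite inE => -[? ?]; apply/andP; split; exact/asboolP.
  by move=> /andP[/asboolP ? /asboolP ?]; rewrite inE.
rewrite -natr_sum (prefix_count_diff cP cQ).
set a := prefix_count n P; set b := prefix_count n Q.
have [ab|ba] := leqP a b.
  move: (ab); rewrite -subn_eq0 => /eqP ->; rewrite mulr0 addr_ge0 ?mulr_ge0//.
  by rewrite invr_ge0 ltW.
have a0 : (0 < a)%N by exact: leq_ltn_trans ba.
have an : (a.-1 < n)%N by rewrite prednK//; exact: prefix_count_le.
have ba1 : (b <= a.-1)%N by rewrite -ltnS prednK.
have /asboolP Pa : P a.-1 by rewrite (prefix_countE cP an) -/a prednK.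
have bn : (b < n)%N by exact: leq_ltn_trans an.
have Qb : fattening r [set y | v y < t b] x.
  have := prefix_countE cQ bn; rewrite -/b ltnn /Q => /negbT; rewrite negbK.
  by move/asboolP.
have := le_trans (td _ _ ba1 an) (ho _ _ Pa Qb).
rewrite -ler_pdivlMl// => H.
rewrite natrB ?(ltnW ba)//.
have aE : a%:R = a.-1%:R + 1 :> R by rewrite natr1 prednK.
move: H; rewrite aE; set c1 : R := _.-1%:R; set c2 : R := b%:R.
by rewrite !mulrDr !mulrN !mulr1; lra.
Qed.

Lemma crossing_count_bound n (h : R) (S : 'I_n -> set T) (x : R) :
  0 <= h -> 0 <= h * \sum_(i < n) \1_(S i) x <= h * n%:R.
Proof.
move=> h0; apply/andP; split.
  by rewrite mulr_ge0// sumr_ge0// => i _; rewrite indicE.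
rewrite ler_wpM2l// -[X in _ <= X%:R]card_ord -sum1_card natr_sum; apply: ler_sum => i _.
by rewrite indicE; case: (_ \in _).
Qed.

End comparison.

(** * Rearrangement of the rounded function *)

Section comparison_theorem.
Context {R : realType}.
Notation mu := (@leb R).
Notation T := (@leb_type R).
Implicit Types (v o : T -> R) (A B : set T).

Lemma nn_mfun_well (W : R -> R) v : double_well W -> measurable_fun setT v ->
  nn_mfun (fun x => W (v x)).
Proof.
move=> dW mv; split => [x|]; first exact: (dw_ge0 dW).
by apply: measurableT_comp mv; apply: continuous_measurable_fun; exact: (dw_continuous dW).
Qed.

Lemma homo_leb_measurable (w : R -> R) : (forall x y, x <= y -> w x <= w y) ->
  measurable_fun setT (w : T -> R).
Proof.
move=> wm; apply: borel_leb_measurable_fun; exact: nondecreasing_measurable.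
Qed.

(** The range of values has length 2, so an error [2 * h] in [c] changes its square by at most
    [4 * h * c <= 8 * h]. *)
Lemma sqr_le_shift (c p h : R) : 0 <= c <= 2 -> 0 <= p -> 0 <= h -> c <= p + 2 * h ->
  c ^+ 2 <= p ^+ 2 + 8 * h.
Proof.
move=> /andP[c0 c2] p0 h0 cp; have [ch|ch] := leP c (2 * h).
  have : c * c <= 2 * (2 * h) by exact: ler_pM.
  have := sqr_ge0 p; rewrite -expr2; lra.
have : (c - 2 * h) ^+ 2 <= p ^+ 2 by apply: lerXn2r; rewrite ?nnegrE; lra.
have : h * c <= h * 2 by exact: ler_wpM2l.
have := sqr_ge0 h; rewrite sqrrB; lra.
Qed.

(** The staircase [w] stays on each intermediate level for exactly the measure of the layer of [v]
    rounded to that level. The function [o] stands for the oscillation of [v]; only its bound on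
    crossed levels enters. *)
Lemma step_comparison (W : R -> R) (r k L h : R) (N : nat) v o :
  double_well W -> 0 < r -> 0 < k < 1 -> 0 <= L -> (0 < N)%N -> h * N%:R = 1 ->
  measurable_fun setT v -> nn_mfun o ->
  (forall (x : R) (s1 s2 : R), fattening r [set y | s2 <= v y] x ->
    fattening r [set y | v y < s1] x -> s2 - s1 <= o x) ->
  mu ([set y | v y < k] `&` `]L, +oo[) = 0%E ->
  mu ([set y | - k < v y] `&` `]-oo, - L[) = 0%E ->
  exists w : R -> R, [/\ admissible w,
    (nnint mu (fun x : T => (w (x + r) - w (x - r)) ^+ 2)%R <=
      (k ^- 2)%:E * nnint mu (fun x => o x ^+ 2)%R + (8 * h * (2 * L + 2 * r))%:E)%E &
    (nnint mu (fun x : T => W (w x)) <= nnint mu (fun x => W (v x)))%E].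
Proof.
move=> dW r0 /andP[k0 k1] L0 N0 hN mv no ho vL vL'.
have Np : 0 < N%:R :> R by rewrite ltr0n.
have h0 : 0 < h by rewrite -(pmulr_lgt0 _ Np) hN.
have h0' := ltW h0.
have hn : h * (N + N)%:R = 2 by rewrite natrD mulrDr hN; lra.
set n := (N + N)%N in hn *.
pose t := threshold N h k.
have tm : nondecreasing_below n t by apply: threshold_homo => //; exact: ltW.
have tb i : (i < n)%N -> - k < t i < k by exact: threshold_bound.
pose A i : set T := [set y | t i <= v y].
pose B i : set T := [set y | v y < t i].
have mB i : measurable (B i).
  rewrite (_ : B i = setT `&` v @^-1` `]-oo, t i[); last first.
    by rewrite setTI; apply/seteqP; split=> x /=; rewrite in_itv.
  by apply: mv; [exact: measurableT|exact: measurable_itv].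
have BA i : B i = ~` A i.
  by apply/seteqP; split=> x; rewrite /A /B /= -?ltNge => ?; [apply/negP; rewrite -ltNge|rewrite ltNge; apply/negP].
have mA i : measurable (A i) by rewrite -[A i]setCK -BA; exact: measurableC.
pose G i := A i `&` B i.+1.
have mG i : measurable (G i) by exact: measurableI.
have mi (i : interval R) : measurable ([set` i] : set T) := itv_leb_measurable i.
have mT1 : measurable ([set y : T | v y < k] `&` `]L, +oo[%classic).
  apply: measurableI; last exact: mi.
  rewrite (_ : [set y | _] = setT `&` v @^-1` `]-oo, k[); last first.
    by rewrite setTI; apply/seteqP; split=> x /=; rewrite in_itv.
  by apply: mv; [exact: measurableT|exact: measurable_itv].
have mT2 : measurable ([set y : T | - k < v y] `&` `]-oo, - L[%classic).
  by apply: measurableI; [exact: (leb_measurable_funP v).1|exact: mi].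
have Gfin i : (i.+1 < n)%N -> mu (G i) \is a fin_num.
  move=> iN; rewrite ge0_fin_numE ?measure_ge0//.
  pose J0 : set T := `[- L, L]%classic.
  apply: (@le_lt_trans _ _ (mu (J0 `|` (([set y | v y < k] `&` `]L, +oo[) `|`
      ([set y | - k < v y] `&` `]-oo, - L[))))).
    apply: leb_le => y [Ay By]; rewrite /A /B /= in Ay By.
    have /andP[ti1 _] := tb i (ltnW iN); have /andP[_ ti2] := tb _ iN.
    have [yL|yL] := ltP y (- L).
      right; right; split; last by rewrite /= ?in_itv.
      exact: lt_le_trans ti1 Ay.
    have [yL'|yL'] := leP y L; first by left; apply/andP.
    right; left; split; last by rewrite /= ?in_itv/= ?andbT.
    exact: lt_trans By ti2.
  apply: (@le_lt_trans _ _ (mu J0 + 0)%E).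
    apply: (le_trans (leb_setU (mi `[- L, L]) (measurableU _ _ mT1 mT2))).
    apply: leeD; first exact: lexx.
    apply: (le_trans (leb_setU mT1 mT2)).
    by rewrite vL vL' adde0.
  rewrite adde0 /J0 leb_itv /=; case: ifP => _; last exact: ltry.
  by rewrite -EFinB; exact: ltry.
(* Layers between two thresholds exist for [i.+1 < n] only; the value [0] merely extends [l] to all
   indices. *)
pose g i := if (i.+1 < n)%N then fine (mu (G i)) else 0.
have g0 i : 0 <= g i by rewrite /g; case: ifP => // _; rewrite fine_ge0// measure_ge0.
(* The shift yields [l N.-1 = 0], and [l N] is then [g N.-1], which is nonnegative: this is the
   normalization at the origin. *)
pose l m := \sum_(0 <= i < m) g i - \sum_(0 <= i < N.-1) g i.
have lS m : l m.+1 = l m + g m by rewrite /l big_nat_recr//= addrAC.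
have lm i j : (i <= j)%N -> l i <= l j.
  elim: j => [|j IH]; first by rewrite leqn0 => /eqP ->.
  rewrite leq_eqVlt => /predU1P[->//|]; rewrite ltnS => /IH /le_trans; apply.
  by rewrite lS lerDl.
have lm' : nondecreasing_below n l by move=> i j ij _; exact: lm.
have AAl i j : (i <= j)%N -> (j < n)%N -> (mu (A i `&` B j) <= (l j - l i)%:E)%E.
  elim: j => [|j IH] ij jn.
    move: ij; rewrite leqn0 => /eqP ->; rewrite subrr BA setICr measure0.
    exact: lexx.
  move: ij; rewrite leq_eqVlt => /predU1P[->|ij].
    by rewrite subrr BA setICr measure0.
  apply: (@le_trans _ _ (mu ((A i `&` B j) `|` G j))).
    apply: leb_le => y [Ay By]; have [vj|vj] := ltP (v y) (t j); first by left.
    by right.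
  apply: (le_trans (leb_setU (measurableI _ _ (mA i) (mB j)) (mG j))).
  apply: (@le_trans _ _ ((l j - l i)%:E + (g j)%:E)%E).
    by apply: leeD; [exact: IH (ltnW jn)|rewrite /g jn fineK// Gfin].
  by rewrite -EFinD lee_fin lS; lra.
pose S (i : 'I_n) : set T := `[l i - r, l i + r[%classic.
pose S' (i : 'I_n) : set T := fattening r (A i) `&` fattening r (B i).
have mS i : measurable (S i) by exact: mi.
have mS' i : measurable (S' i).
  by apply: measurableI; apply: measurable_fattening.
pose w : R -> R := step_fun n h l.
have aw : admissible w.
  apply: step_fun_admissible => //; first by rewrite /l subrr.
  by rewrite /l subr_ge0 -{2}[N]prednK// big_nat_recr//= lerDl.
have mw := homo_leb_measurable (adm_homo aw).
exists w; split => //.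
- apply: (@le_trans _ _ (nnint mu (fun x => (h * \sum_(i < n) \1_(S i) x) ^+ 2)%R)).
    rewrite le_eqVlt; apply/orP; left; apply/eqP; congr (nnint mu _).
    by apply/funext => x; rewrite /w step_fun_increment.
  apply: (@le_trans _ _ (nnint mu (fun x => (h * \sum_(i < n) \1_(S' i) x) ^+ 2)%R)).
    apply: nnint_sqr_sum_indic_le => // i j ij.
    (* For [i <= j] the two intervals meet in length [2 * r - (l j - l i)] or not at all. As [A j]
       lies in [A i] and [B i] in [B j], the overlap of the fattenings of [A j] and [B i] is
       contained in all four fattenings, and the set missed by [A j] and [B i] is [A i] intersected
       with [B j]. *)
    pose Jij : set T := `[l j - r, l i + r[%classic.
    apply: (@le_trans _ _ (mu Jij)).
      apply: leb_le => y []; rewrite /S /= !in_itv/= => /andP[_ ?] /andP[? _].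
      exact/andP.
    rewrite /Jij leb_itv /= lte_fin; case: ifPn => [lji|_]; last exact: measure_ge0.
    have jn := ltn_ord j; have in_ := ltn_ord i.
    have ov : ((2 * r - (l j - l i))%:E <= mu (fattening r (A j) `&` fattening r (B i)))%E.
      apply: (@fattening_overlap _ _ _ _ L) => //.
      + apply/seteqP; split => y // -[]; rewrite /A /B /= => h1 h2.
        have := le_lt_trans h1 h2; rewrite ltNge.
        by rewrite (tm i j).
      + rewrite (_ : ~` A j = B j); last by rewrite BA.
        apply/eqP; rewrite eq_le measure_ge0 andbT -vL.
        apply: leb_le => y [By yL]; split => //.
        by have /andP[_] := tb j jn; exact: lt_trans.
      + rewrite (_ : ~` B i = A i); last by rewrite BA setCK.
        apply/eqP; rewrite eq_le measure_ge0 andbT -vL'.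
        apply: leb_le => y [Ay yL]; split => //.
        by have /andP[+ _] := tb i in_; move=> /lt_le_trans; apply.
      + rewrite (_ : ~` _ = A i `&` B j); first exact: AAl.
        by rewrite setCU (BA i) setCK -BA setIC.
    rewrite -EFinB; apply: (@le_trans _ _ (2 * r - (l j - l i))%:E).
      by rewrite lee_fin; lra.
    apply: (le_trans ov); apply: leb_le => y [Fj Fi].
    split; split => //; [apply: fattening_sub Fj|apply: fattening_sub Fi] => z /=.
      by apply: le_trans; exact: tm.
    by move=> /lt_le_trans; apply; exact: tm.
  (* Outside [J] the window of [x] lies in one tail, where no threshold is crossed; the rounding
     error is thus confined to length [2 * L + 2 * r]. *)
  pose J : set T := `[- L - r, L + r]%classic.
  have nS' := nn_mfun_sum_indic h0' mS'.
  have no2 : nn_mfun (fun x => o x ^+ 2) by apply: nn_mfun_mul.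
  have nk : 0 <= k ^- 2 by rewrite invr_ge0 exprn_ge0// ltW.
  have n8 : 0 <= 8 * h by rewrite mulr_ge0.
  have nJ : nn_mfun (\1_J : T -> R) by apply: nn_mfun_indic; exact: mi.
  apply: (@le_trans _ _ (nnint mu (fun x => k ^- 2 * o x ^+ 2 + 8 * h * \1_J x)%R)).
    have nR : nn_mfun (fun x => k ^- 2 * o x ^+ 2 + 8 * h * \1_J x).
      by apply: nn_mfun_add; exact: nn_mfun_scale.
    apply: (nnint_le mu nS' nR) => x; have [Jx|Jx] := pselect (J x); last first.
      rewrite big1 => [|i _].
        rewrite mulr0 expr0n /=; apply: addr_ge0; apply: mulr_ge0 => //.
        exact: sqr_ge0.
      rewrite indicE memNset// => -[FA FB].
      have /andP[t1 t2] := tb i (ltn_ord i).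
      apply: Jx; rewrite /J /= in_itv/=; apply/andP; split.
        rewrite leNgt; apply/negP => xL; move/negP: FA; apply.
        apply/eqP/eqP; rewrite eq_le measure_ge0 andbT -vL'.
        apply: leb_le => y [Ay]; rewrite /= !in_itv/= => /andP[_ yx]; split.
          exact: lt_le_trans t1 Ay.
        by rewrite /= ?in_itv/=; lra.
      rewrite leNgt; apply/negP => xL; move/negP: FB; apply.
      apply/eqP/eqP; rewrite eq_le measure_ge0 andbT -vL.
      apply: leb_le => y [By]; rewrite /= !in_itv/= => /andP[yx _]; split.
        exact: lt_trans By t2.
      by rewrite /= ?in_itv/= ?andbT; lra.
    rewrite indicE mem_set// mulr1 -exprVn -exprMn.
    apply: sqr_le_shift => //.
    + by have := crossing_count_bound S' x h0'; rewrite hn.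
    + by apply: mulr_ge0; [rewrite invr_ge0 ltW|exact: no.1].
    + apply: crossing_count_le => //.
      * by move=> i j ij jn; apply: threshold_diff => //; exact: ltW.
      * exact: no.1.
      * exact: ho.
  rewrite nnint_add; last 2 first.
  + exact: nn_mfun_scale.
  + exact: nn_mfun_scale.
  rewrite nnint_scale// nnint_scale// nnint_indic; last exact: mi.
  rewrite leeD2l// leb_itv /= lte_fin; case: ifPn => _; last first.
    by rewrite mule0 lee_fin !mulr_ge0//; lra.
  rewrite -EFinB -EFinM lee_fin ler_wpM2l//; lra.
- pose a (m : 'I_n.-1) : R := W (-1 + h * m.+1%:R).
  have a0 m : 0 <= a m by exact: (dw_ge0 dW).
  pose I (m : 'I_n.-1) : set T := `[l m, l m.+1[%classic.
  have mI m : measurable (I m) by exact: mi.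
  apply: (@le_trans _ _ (nnint mu (fun x => \sum_(m < n.-1) a m * \1_(I m) x)%R)).
    rewrite le_eqVlt; apply/orP; left; apply/eqP; congr (nnint mu _).
    by apply/funext => x; rewrite /w step_fun_well//; [exact: (dw_m1 dW)|exact: (dw_1 dW)].
  rewrite nnint_sum_indic//.
  (* Between its jumps [m] and [m.+1] the staircase stays for the measure of [G m]. *)
  apply: (@le_trans _ _ (\sum_(m < n.-1) (a m)%:E * mu (G m))%E).
    apply: lee_sum => m _; apply: lee_wpmul2l; first by rewrite lee_fin.
    have mn : (m.+1 < n)%N by have := ltn_ord m; rewrite -ltnS prednK// addn_gt0 N0.
    rewrite leb_itv /= lte_fin; case: ifPn => [_|_]; last exact: measure_ge0.
    by rewrite -EFinB lS addrAC subrr add0r /g mn fineK// Gfin.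
  have nG : nn_mfun (fun x => \sum_(m < n.-1) a m * \1_(G m) x).
    by apply: nn_mfun_sum => m; apply: nn_mfun_scale => //; exact: nn_mfun_indic.
  rewrite -nnint_sum_indic//.
  (* The sum over the layers is [W] of the rounded [v], and rounding lowers [W]. *)
  apply: (nnint_le mu nG (nn_mfun_well dW mv)) => x; apply: le_trans (@threshold_well _ N h k W (v x) dW _ N0 hN); last first.
    by rewrite k0 ltW.
  rewrite (step_fun_well (n := n) _ tm)//; [|exact: (dw_m1 dW)|exact: (dw_1 dW)].
  apply: ler_sum => m _; rewrite le_eqVlt; apply/orP; left; apply/eqP; congr (_ * _).
  rewrite !indicE; congr ((nat_of_bool _)%:R).
  by apply/idP/idP; rewrite !inE /G /A /B /= in_itv/= => h1; exact/andP.
Qed.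

End comparison_theorem.

(** * Existence of a monotone minimizer *)

Section monotone_jumps.
Context {R : realType}.
Implicit Types u : R -> R.

(** A separating rational is attached to each point instead of one-sided limits, which makes
    countability immediate. The set contains every discontinuity of a monotone [u], but possibly
    also points of continuity where [u] takes a rational value, as for the identity. *)
Definition jumps u : set R := [set x | exists q : rat,
  (forall y, y < x -> u y < ratr q) /\ (forall z, x < z -> ratr q < u z)].

(** The chosen rationals are distinct: the value of [u] halfway between two jump points exceeds the
    first rational and is below the second. The map [f] will be a translation by [r] or [- r], or
    the identity. *)
Lemma countable_jumps_preimage u (f : R -> R) : (forall x y, x < y -> f x < f y) ->
  countable [set x | jumps u (f x)].
Proof.
move=> fm; apply/countable_injP.
pose q x : rat := xget 0%Q [set q : rat |
  (forall y, y < f x -> u y < ratr q) /\ (forall z, f x < z -> ratr q < u z)].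
have qP x : jumps u (f x) ->
    (forall y, y < f x -> u y < ratr (q x)) /\ (forall z, f x < z -> ratr (q x) < u z).
  by move=> [p hp]; rewrite /q; case: xgetP => [_ _ //|/(_ p)].
have qlt x y : jumps u (f x) -> jumps u (f y) -> x < y -> q x != q y.
  move=> /qP[_ hx] /qP[hy _] /fm xy; apply/negP => /eqP qE.
  have h1 := hx ((f x + f y) / 2) (midf_lt xy).1.
  have := hy ((f x + f y) / 2) (midf_lt xy).2.
  by rewrite -qE ltNge (ltW h1).
exists (fun x => choice.pickle (q x)) => x y; rewrite !inE => Jx Jy.
move=> /(pcan_inj choice.pickleK) qE; apply/eqP.
have [xy|xy|//] := ltgtP x y.
- by have := qlt _ _ Jx Jy xy; rewrite qE eqxx.
- by have := qlt _ _ Jy Jx xy; rewrite qE eqxx.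
Qed.

(** If the gap were always at least [e], any rational between the left limit [sup S] and [sup S + e]
    would separate the two sides. *)
Lemma not_jump_near u (x e : R) : (forall x y, x <= y -> u x <= u y) ->
  ~ jumps u x -> 0 < e ->
  exists y z : R, [/\ y < x, x < z & u z - u y < e].
Proof.
move=> um nJ e0; apply: contrapT => h; apply: nJ.
have h' y z : y < x -> x < z -> e <= u z - u y.
  by move=> yx xz; rewrite leNgt; apply/negP => uzy; apply: h; exists y, z.
pose S := u @` [set y | y < x].
have hsS : has_sup S.
  split; first by exists (u (x - 1)); exists (x - 1) => //=; lra.
  by exists (u x) => _ [y /= yx <-]; apply: um; exact: ltW.
have [q] := rat_in_itvoo (ltac:(lra) : sup S < sup S + e).
rewrite in_itv/= => /andP[q1 q2]; exists q; split => [y yx|z xz].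
  by apply: le_lt_trans q1; apply: (ub_le_sup hsS.2); exists y.
apply: (lt_le_trans q2); rewrite -lerBrDr; apply: ge_sup; first exact: hsS.1.
by move=> _ [y /= yx <-]; have := h' _ _ yx xz; lra.
Qed.

End monotone_jumps.

(** * Helly's selection theorem *)

Section helly.
Context {R : realType}.

(** The limit is taken along an ultrafilter refining the filter at infinity, so it exists at every
    point and inherits monotonicity and bounds. A sequence of indices converging at the rationals is
    extracted afterwards, and monotonicity carries the convergence over to all points outside
    [jumps u]. The indices need not increase; [k <= s k] is enough. *)
Lemma helly_selection (w : nat -> R -> R) :
  (forall n x y, x <= y -> w n x <= w n y) -> (forall n x, -1 <= w n x <= 1) ->
  exists (s : nat -> nat) (u : R -> R),
    [/\ forall k, (k <= s k)%N,
        forall x (c : R), (forall n, c <= w n x) -> c <= u x,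
        forall x (c : R), (forall n, w n x <= c) -> u x <= c,
        forall x y, x <= y -> u x <= u y &
        forall x, ~ jumps u x -> (fun k => w (s k) x) @ \oo --> u x].
Proof.
move=> wm wb.
have [U [uU Uoo]] := ultraFilterLemma (eventually_filter : ProperFilter (nbhs \oo)).
have pU : ProperFilter U by exact: ultra_proper.
pose S x := [set t : R | U [set n | t <= w n x]].
have S1 x : S x (-1) by apply: filterS filterT => n _ /=; have /andP[] := wb n x.
have Sub x t : S x t -> t <= 1.
  move=> St; have [n /= tn] := filter_ex St.
  by apply: (le_trans tn); have /andP[] := wb n x.
have hsS x : has_sup (S x) by split; [exists (-1)|exists 1 => t; exact: Sub].
pose u x := sup (S x).
have Slow x e : 0 < e -> U [set n | u x - e < w n x].
  move=> e0; have [t St ut] := sup_adherent e0 (hsS x).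
  by apply: filterS St => n /=; exact: lt_le_trans.
have Supp x e : 0 < e -> U [set n | w n x < u x + e].
  move=> e0; have [h|h] := in_ultra_setVsetC [set n | u x + e <= w n x] uU.
    by have := ub_le_sup (hsS x).2 (h : S x (u x + e)); rewrite -/(u x); lra.
  by apply: filterS h => n /= /negP; rewrite -ltNge.
have um x y : x <= y -> u x <= u y.
  move=> xy; apply: ge_sup; first by exists (-1).
  move=> t St; apply: (ub_le_sup (hsS y).2).
  by apply: filterS St => n /= /le_trans; apply; exact: wm.
pose q (i : nat) : R := if choice.unpickle i is Some p then ratr (p : rat) else 0.
(* Diagonal extraction: one index serves the first [k.+1] entries of the enumeration, as finite
   intersections stay in the ultrafilter. *)
have Uk k : U [set n | (k <= n)%N /\ forall i, (i <= k)%N ->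
    u (q i) - k.+1%:R^-1 < w n (q i) < u (q i) + k.+1%:R^-1].
  have k0 : 0 < k.+1%:R^-1 :> R by rewrite invr_gt0.
  apply: filterI; first by apply: Uoo; exact: nbhs_infty_ge.
  have : forall m, U [set n | forall i, (i <= m)%N ->
      u (q i) - k.+1%:R^-1 < w n (q i) < u (q i) + k.+1%:R^-1].
    elim=> [|m IH].
      apply: filterS2 (Slow (q 0%N) _ k0) (Supp (q 0%N) _ k0) => n /= h1 h2 i.
      by rewrite leqn0 => /eqP ->; rewrite h1.
    apply: filterS3 IH (Slow (q m.+1) _ k0) (Supp (q m.+1) _ k0) => n /= h h1 h2 i.
    by rewrite leq_eqVlt => /predU1P[->|]; [rewrite h1|exact: h].
  exact.
have [s sP] := choice (fun k => filter_ex (Uk k)).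
exists s, u; split.
- by move=> k; have [] := sP k.
- move=> x c cw; apply: (ub_le_sup (hsS x).2).
  by apply: filterS filterT => n _; exact: cw.
- move=> x c wc; apply: ge_sup; first by exists (-1).
  by move=> t St; have [n /= tn] := filter_ex St; exact: le_trans (wc n).
- exact: um.
- move=> x Jx; apply/cvgrPdist_lt => e e0.
  have e20 : 0 < e / 2 by lra.
  have [y [z [yx xz uyz]]] := not_jump_near um Jx e20.
  have [p1] := rat_in_itvoo yx; rewrite in_itv/= => /andP[yp1 p1x].
  have [p2] := rat_in_itvoo xz; rewrite in_itv/= => /andP[xp2 p2z].
  have q1 : q (choice.pickle p1) = ratr p1 by rewrite /q choice.pickleK.
  have q2 : q (choice.pickle p2) = ratr p2 by rewrite /q choice.pickleK.
  near=> k.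
  have ke : k.+1%:R^-1 < e / 2 by near: k; exact: near_infty_natSinv_lt (PosNum e20).
  have [_ hk] := sP k.
  have /andP[h1 _] : u (q (choice.pickle p1)) - k.+1%:R^-1 < w (s k) (q (choice.pickle p1))
      < u (q (choice.pickle p1)) + k.+1%:R^-1.
    by apply: hk; near: k; exact: nbhs_infty_ge.
  have /andP[_ h2] : u (q (choice.pickle p2)) - k.+1%:R^-1 < w (s k) (q (choice.pickle p2))
      < u (q (choice.pickle p2)) + k.+1%:R^-1.
    by apply: hk; near: k; exact: nbhs_infty_ge.
  rewrite q1 in h1; rewrite q2 in h2.
  move: ke h1 h2; set d := _^-1 => ke h1 h2.
  have := um _ _ (ltW yp1); have := um _ _ (ltW p2z).
  have := um _ _ (ltW yx); have := um _ _ (ltW xz).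
  have := wm (s k) _ _ (ltW p1x); have := wm (s k) _ _ (ltW xp2).
  by move=> ? ? ? ? ? ?; rewrite ltr_norml; apply/andP; split; lra.
Unshelve. all: by end_near. Qed.

End helly.

(** * Minimizers of the increment energy *)

Section existence.
Context {R : realType}.
Notation mu := (@leb R).
Notation T := (@leb_type R).
Implicit Types (W w u : R -> R) (r : R).

Definition increment_density W r w (x : T) : R :=
  (w (x + r) - w (x - r)) ^+ 2 / (2 * r ^+ 2) + W (w x).

Definition increment_energy W r w : \bar R := nnint mu (increment_density W r w).

Lemma nn_mfun_sqr_increment r w : admissible w ->
  nn_mfun (fun x : T => (w (x + r) - w (x - r)) ^+ 2).
Proof.
move=> aw; have wm := adm_homo aw.
split => [x|]; first exact: sqr_ge0.
apply: measurable_funX; apply: measurable_funB.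
- by apply: (@homo_leb_measurable R (fun x => w (x + r))) => x y xy; apply: wm; rewrite lerD2r.
- by apply: (@homo_leb_measurable R (fun x => w (x - r))) => x y xy; apply: wm; rewrite lerD2r.
Qed.

Lemma nn_mfun_increment_density W r w : double_well W -> admissible w ->
  nn_mfun (increment_density W r w).
Proof.
move=> dW aw; apply: nn_mfun_add.
  apply: nn_mfun_mul; first exact: nn_mfun_sqr_increment.
  by apply: nn_mfun_cst; rewrite invr_ge0 mulr_ge0// sqr_ge0.
exact: (nn_mfun_well dW (homo_leb_measurable (adm_homo aw))).
Qed.

Lemma increment_energyE W r w : double_well W -> admissible w ->
  increment_energy W r w =
  (((2 * r ^+ 2)^-1)%:E * nnint mu (fun x : T => (w (x + r) - w (x - r)) ^+ 2)%R +
   nnint mu (fun x : T => W (w x)))%E.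
Proof.
move=> dW aw; rewrite /increment_energy /increment_density.
have k0 : 0 <= (2 * r ^+ 2)^-1 by rewrite invr_ge0 mulr_ge0// sqr_ge0.
rewrite nnint_add; last 2 first.
- by apply: nn_mfun_mul; [exact: nn_mfun_sqr_increment|exact: nn_mfun_cst].
- exact: (nn_mfun_well dW (homo_leb_measurable (adm_homo aw))).
rewrite -(nnint_scale mu (nn_mfun_sqr_increment r aw) k0).
by congr (nnint mu _ + _)%E; apply/funext => x; rewrite mulrC.
Qed.

Lemma cvg_increment_density W r (w : nat -> R -> R) u (x : R) : double_well W ->
  (fun k => w k (x + r)) @ \oo --> u (x + r) ->
  (fun k => w k (x - r)) @ \oo --> u (x - r) ->
  (fun k => w k x) @ \oo --> u x ->
  (fun k => increment_density W r (w k) x) @ \oo --> increment_density W r u x.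
Proof.
move=> dW c1 c2 c3; apply: cvgD; last first.
  by apply: (continuous_cvg _ _ c3); exact: (dw_continuous dW).
apply: cvgMr_tmp; rewrite /= !expr2.
by under eq_fun do rewrite expr2; apply: cvgM; apply: cvgB.
Qed.

(** Both unit jumps sit at [0], so the middle level is skipped: this is the sign function with value
    [1] at the origin. *)
Definition sign_step : R -> R := step_fun (1 + 1) 1 (fun=> 0).

Lemma admissible_sign_step : admissible sign_step.
Proof. by apply: step_fun_admissible => //; rewrite mulr1. Qed.

Lemma exists_minimizer W r : double_well W ->
  exists u, admissible u /\
    forall w, admissible w -> (increment_energy W r u <= increment_energy W r w)%E.
Proof.
move=> dW; pose E := [set increment_energy W r w | w in [set w | admissible w]].
pose m := ereal_inf E.
have Em w : admissible w -> (m <= increment_energy W r w)%E.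
  by move=> aw; apply: ereal_inf_lbound; exists w.
have m0 : (0 <= m)%E.
  apply: le_ereal_inf_tmp => _ [w aw <-]; apply: nnint_ge0.
  exact: (nn_mfun_increment_density r dW aw).1.
(* With an infinite infimum every admissible function is a minimizer. *)
have [moo|moo] := eqVneq m +oo%E.
  exists sign_step; split; first exact: admissible_sign_step.
  by move=> w /Em; rewrite moo leye_eq => /eqP ->; exact: leey.
have mfin : m \is a fin_num by rewrite ge0_fin_numE// ltey.
have i0 (n : nat) : 0 < n.+1%:R^-1 :> R by rewrite invr_gt0.
have wE n : exists w, admissible w /\
    (increment_energy W r w <= (fine m + n.+1%:R^-1)%:E)%E.
  have [_ [w aw <-] /ltW h] := lb_ereal_inf_adherent (i0 n) mfin.
  by exists w; split => //; rewrite EFinD fineK.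
have [w wP] := choice wE.
have wm n := adm_homo (wP n).1.
have [s [u [sk ulo uhi um cvu]]] := helly_selection wm (fun n => adm_bound (wP n).1).
have au : admissible u.
  split => // [x|x x0|x x0].
  - apply/andP; split; first by apply: ulo => n; have /andP[] := adm_bound (wP n).1 x.
    by apply: uhi => n; have /andP[] := adm_bound (wP n).1 x.
  - by apply: uhi => n; exact: (adm_neg (wP n).1).
  - by apply: ulo => n; exact: (adm_pos (wP n).1).
exists u; split => // v av; apply: le_trans (Em v av).
rewrite -(fineK mfin).
(* The density at [x] involves the values at [x + r], [x - r] and [x]; off this countable set all
   three converge. *)
pose D : set R := [set x | jumps u (x + r)] `|` [set x | jumps u (x - r)] `|` [set x | jumps u x].
have cD : countable D.
  have cU (A B : set R) : countable A -> countable B -> countable (A `|` B).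
    by move=> cA cB; rewrite -bigcup2E; apply: bigcup_countable => // -[|[|?]] _ //=.
  apply: (cU _ _ (cU _ _ _ _)); apply: countable_jumps_preimage => //.
  - by move=> x y xy; rewrite ltrD2r.
  - by move=> x y xy; rewrite ltrD2r.
have D0 : leb (D : set T) = 0%E by exact: countable_lebesgue_measure0.
apply: (@nnint_fatou _ _ _ mu (fun k => increment_density W r (w (s k))) _
  (fun k => fine m + k.+1%:R^-1) _ (D : set T)) => //.
- by move=> k; apply: nn_mfun_increment_density => //; exact: (wP _).1.
- exact: nn_mfun_increment_density.
- exact: leb_eq0_measurable.
- move=> x nD; apply: cvg_increment_density => //; apply: cvu => J; apply: nD.
  + by left; left.
  + by left; right.
  + by right.
- move=> k; apply: (le_trans (wP (s k)).2); rewrite lee_fin lerD2l.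
  by rewrite lef_pV2 ?posrE// ler_nat ltnS.
- rewrite -[X in _ --> X]addr0; apply: cvgD; first exact: cvg_cst.
  exact: cvg_harmonic.
Qed.

End existence.

(** * Energy bounds *)

Section energy_bounds.
Context {R : realType}.
Notation mu := (@leb R).
Notation T := (@leb_type R).
Implicit Types (W w u : R -> R) (r : R).

(** The increment is [2] on an interval of length [2 * r] and the potential vanishes, which gives
    [4 / (2 * r ^+ 2) * (2 * r)]. *)
Lemma increment_energy_sign_step W r : double_well W -> 0 < r ->
  (increment_energy W r (@sign_step R) <= (4 / r)%:E)%E.
Proof.
move=> dW r0.
have eW x : W (@sign_step R x) = 0.
  rewrite /sign_step /step_fun /prefix_count !big_ord_recl big_ord0 /=.
  case: (0 <= x); rewrite /= ?mulr0 ?addr0 ?(dw_m1 dW)//.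
  by rewrite (_ : -1 + 1 * 2%:R = 1) ?(dw_1 dW)//; lra.
pose J : set T := `[- r, r[%classic.
have mJ : measurable J by exact: itv_leb_measurable.
have k0 : 0 <= 2 / r ^+ 2 by rewrite divr_ge0// sqr_ge0.
have dE : increment_density W r (@sign_step R) = (fun x => 2 / r ^+ 2 * \1_J x).
  apply/funext => x; rewrite /increment_density eW addr0 /sign_step step_fun_increment//.
  rewrite !big_ord_recl big_ord0 sub0r add0r -/J addr0 mul1r.
  have -> : (\1_J x + \1_J x) ^+ 2 = 4 * \1_J x :> R.
    by rewrite indicE; case: (_ \in _); rewrite /=; ring.
  by field; rewrite gt_eqF.
rewrite /increment_energy dE (nnint_scale mu (nn_mfun_indic mJ) k0) (nnint_indic mu mJ).
rewrite /J leb_itv /= lte_fin ifT; last by lra.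
rewrite -EFinB -EFinM lee_fin le_eqVlt; apply/orP; left; apply/eqP.
by field; rewrite gt_eqF.
Qed.

(** For the staircase below the identity the increment is at most [2 * r + h] and has integral
    [4 * r]. Its square thus integrates to at most [(2 * r + h) * (4 * r)], that is, [4 + 2 * h / r]
    after division by [2 * r ^+ 2]. *)
Lemma increment_energy_uniform_step W r h N : double_well W -> 0 < r ->
  (0 < N)%N -> h * N%:R = 1 ->
  exists w, admissible w /\
   (increment_energy W r w <=
     (4 + 2 * h / r + \sum_(m < (N + N).-1) W (-1 + h * m.+1%:R) * h)%:E)%E.
Proof.
move=> dW r0 N0 hN.
have Np : 0 < N%:R :> R by rewrite ltr0n.
have h0 : 0 < h by rewrite -(pmulr_lgt0 _ Np) hN.
have h0' := ltW h0.
have hn : h * (N + N)%:R = 2 by rewrite natrD mulrDr hN; lra.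
set n := (N + N)%N in hn *.
pose l (i : nat) : R := -1 + h * i.+1%:R.
have lE i j : l j - l i = h * (j%:R - i%:R).
  by rewrite /l -!natr1; ring.
have lm : nondecreasing_below n l.
  by move=> i j ij _; rewrite -subr_ge0 lE mulr_ge0// subr_ge0 ler_nat.
pose w : R -> R := step_fun n h l.
have aw : admissible w.
  apply: step_fun_admissible => //; rewrite /l ?prednK// ?hN; first by lra.
  by rewrite -natr1 mulrDr hN; lra.
have mi (i : interval R) : measurable ([set` i] : set T) := itv_leb_measurable i.
have Dle x : w (x + r) - w (x - r) <= 2 * r + h.
  rewrite /w /step_fun; set a := prefix_count n _; set b := prefix_count n _.
  rewrite opprD addrACA subrr add0r -mulrBr.
  have [ab|ba] := leqP a b.
    apply: (@le_trans _ _ 0); last by lra.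
    by rewrite mulr_ge0_le0// subr_le0 ler_nat.
  have a0 : (0 < a)%N by exact: leq_ltn_trans ba.
  have an : (a.-1 < n)%N by rewrite prednK//; exact: prefix_count_le.
  have bn : (b < n)%N by apply: (leq_trans ba); exact: prefix_count_le.
  have h1 : l a.-1 <= x + r.
    by rewrite (prefix_countE (prefix_closed_le lm) an) -/a prednK.
  have h2 : x - r < l b.
    by rewrite ltNge (prefix_countE (prefix_closed_le lm) bn) -/b ltnn.
  have := lE b a.-1; rewrite -[X in _ = _ * (X - _)](addrK 1) natr1 prednK// => E.
  have : h * (a%:R - b%:R) = l a.-1 - l b + h by rewrite E; ring.
  by move=> ->; lra.
exists w; split => //; rewrite increment_energyE// EFinD.
have nS := nn_mfun_sqr_increment r aw.
pose S (i : 'I_n) : set T := `[l i - r, l i + r[%classic.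
have mS i : measurable (S i) by exact: mi.
have rn : 0 <= 2 * r + h by lra.
have k0 : 0 <= (2 * r ^+ 2)^-1 by rewrite invr_ge0 mulr_ge0// sqr_ge0.
have nI : nn_mfun (fun x : T => \sum_(i < n) h * \1_(S i) x).
  by apply: nn_mfun_sum => i; apply: nn_mfun_scale => //; exact: nn_mfun_indic.
apply: leeD.
  apply: (@le_trans _ _ (((2 * r ^+ 2)^-1)%:E * ((2 * r + h)%:E * (4 * r)%:E))%E).
    apply: lee_wpmul2l; first by rewrite lee_fin.
    rewrite (_ : (4 * r)%:E = nnint mu (fun x : T => \sum_(i < n) h * \1_(S i) x)%R).
      rewrite -(nnint_scale mu nI rn); apply: (nnint_le mu nS (nn_mfun_scale nI rn)) => x.
      rewrite -mulr_sumr -step_fun_increment// -/w expr2 ler_wpM2r//.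
      by rewrite subr_ge0; apply: (adm_homo aw); lra.
    rewrite (nnint_sum_indic mu _ (fun=> h0') mS).
    rewrite (eq_bigr (fun=> (h * (2 * r))%:E)).
      rewrite sumEFin sumr_const card_ord -[X in _ = X%:E]mulr_natr.
      rewrite (_ : h * (2 * r) * n%:R = h * n%:R * (2 * r)); last by ring.
      by rewrite hn; congr (_%:E); ring.
    move=> i _; rewrite /S leb_itv /= lte_fin ifT; last by lra.
    by rewrite -EFinB -EFinM; congr (_%:E); ring.
  rewrite -!EFinM lee_fin le_eqVlt; apply/orP; left; apply/eqP.
  by field; rewrite gt_eqF.
rewrite (_ : (fun x : T => W (w x)) =
    (fun x : T => \sum_(k < n.-1) W (-1 + h * k.+1%:R) * \1_(`[l k, l k.+1[%classic : set T) x)).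
  rewrite nnint_sum_indic//; last by move=> i; exact: (dw_ge0 dW).
  rewrite -sumEFin; apply: lee_sum => i _; rewrite EFinM; apply: lee_wpmul2l.
    by rewrite lee_fin; exact: (dw_ge0 dW).
  rewrite leb_itv /= lte_fin; case: ifP => _; last by rewrite lee_fin.
  by rewrite -EFinB lee_fin lE -natr1; lra.
by apply/funext => x; rewrite /w step_fun_well//; [exact: (dw_m1 dW)|exact: (dw_1 dW)].
Qed.

(** If the energy is [M], a stretch of length [M / c + 1] with potential at least [c] would already
    cost [M + c]. *)
Lemma increment_energy_lty_not_ge W r u (c a : R) : double_well W -> admissible u ->
  (increment_energy W r u < +oo)%E -> 0 < c ->
  ~ (forall x, a <= x -> c <= W (u x)) /\ ~ (forall x, x <= a -> c <= W (u x)).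
Proof.
move=> dW au fin c0.
have nD := nn_mfun_increment_density r dW au.
have Wle x : W (u x) <= increment_density W r u x.
  by rewrite lerDr divr_ge0 ?sqr_ge0// mulr_ge0// sqr_ge0.
have [M ME] : exists M : R, increment_energy W r u = M%:E.
  exists (fine (increment_energy W r u)); rewrite fineK// ge0_fin_numE//.
  exact: nnint_ge0 nD.1.
have M0 : 0 <= M by rewrite -lee_fin -ME; exact: nnint_ge0 nD.1.
have key (b : R) : ~ (forall x, b <= x -> x <= b + (M / c + 1) -> c <= W (u x)).
  move=> h; pose J : set T := `[b, b + (M / c + 1)]%classic.
  have mJ : measurable J by exact: itv_leb_measurable.
  have nJ := nn_mfun_scale (nn_mfun_indic mJ) (ltW c0).
  have : (nnint mu (fun x : T => c * \1_J x)%R <= increment_energy W r u)%E.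
    apply: (nnint_le mu nJ nD) => x; apply: le_trans (Wle x).
    have [Jx|Jx] := pselect (J x).
      rewrite indicE mem_set// mulr1; move: Jx; rewrite /J /= in_itv/= => /andP[? ?].
      exact: h.
    by rewrite indicE memNset// mulr0; exact: (dw_ge0 dW).
  rewrite (nnint_scale mu (nn_mfun_indic mJ) (ltW c0)) (nnint_indic mu mJ) ME.
  have Mc : 0 <= M / c by rewrite divr_ge0// ltW.
  rewrite /J leb_itv /= lte_fin ifT; last by lra.
  rewrite -EFinB -EFinM lee_fin addrC addKr mulrDr mulrC divfK ?gt_eqF//.
  lra.
split=> h.
- by apply: (key a) => x ax _; exact: h.
- apply: (key (a - (M / c + 1))) => x _; rewrite subrK; exact: h.
Qed.

(** A nondecreasing [u] that does not tend to [1] stays below some [1 - d]. On the positive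
    half-line it then lies between [0] and [1 - d], where the potential is at least [W (1 - d) > 0];
    the other end is symmetric. *)
Lemma admissible_limits W r u : double_well W -> admissible u ->
  (increment_energy W r u < +oo)%E ->
  (forall e : R, 0 < e -> exists M, forall x, M < x -> `|u x - 1| < e) /\
  (forall e : R, 0 < e -> exists M, forall x, x < M -> `|u x + 1| < e).
Proof.
move=> dW au fin; have um := adm_homo au.
have near0 (e : R) : 0 < e -> exists d : R, [/\ 0 < d, d <= e & d < 1].
  move=> e0; exists (Num.min e (1 / 2)); split; last by rewrite gt_min; apply/orP; right; lra.
    by rewrite lt_min e0 /=; lra.
  by rewrite ge_min lexx.
split => e /near0[d [d0 de d1]].
- apply: contrapT => h.
  have ud x : u x <= 1 - d.
    rewrite leNgt; apply/negP => ux; apply: h; exists x => y xy.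
    have /andP[_ ?] := adm_bound au y; have := um _ _ (ltW xy).
    by move=> ?; rewrite ltr_norml; apply/andP; split; lra.
  have Wd : 0 < W (1 - d) by apply: (dw_gt0 dW); apply/eqP; lra.
  have [+ _] := increment_energy_lty_not_ge 0 dW au fin Wd.
  apply => x x0; apply: (dw_decr dW) => //; first exact: (adm_pos au).
  lra.
- apply: contrapT => h.
  have ud x : -1 + d <= u x.
    rewrite leNgt; apply/negP => ux; apply: h; exists x => y xy.
    have /andP[? _] := adm_bound au y; have := um _ _ (ltW xy).
    by move=> ?; rewrite ltr_norml; apply/andP; split; lra.
  have Wd : 0 < W (-1 + d) by apply: (dw_gt0 dW); apply/eqP; lra.
  (* The base point is [-1] because [u] is known to be nonpositive only at strictly negative
     points. *)
  have [_] := increment_energy_lty_not_ge (-1) dW au fin Wd.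
  apply => x x0; apply: (dw_incr dW) => //; first by lra.
  by apply: (adm_neg au); lra.
Qed.

End energy_bounds.

(** * Minimality among general competitors *)

Section minimality.
Context {R : realType}.
Notation mu := (@leb R).
Notation T := (@leb_type R).
Implicit Types (W w u : R -> R) (r : R) (v o : T -> R).

Lemma minimizer_le W r u v o : double_well W -> 0 < r -> admissible u ->
  (forall w, admissible w -> (increment_energy W r u <= increment_energy W r w)%E) ->
  measurable_fun setT v -> nn_mfun o ->
  (forall (x : R) (s1 s2 : R), fattening r [set y | s2 <= v y] x ->
    fattening r [set y | v y < s1] x -> s2 - s1 <= o x) ->
  (forall k : R, 0 < k < 1 -> exists2 L : R, 0 <= L &
    mu ([set y | v y < k] `&` `]L, +oo[) = 0%E /\
    mu ([set y | - k < v y] `&` `]-oo, - L[) = 0%E) ->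
  (increment_energy W r u <=
   ((2 * r ^+ 2)^-1)%:E * nnint mu (fun x => o x ^+ 2)%R + nnint mu (fun x => W (v x)))%E.
Proof.
move=> dW r0 au umin mv no ho tails.
pose c := (2 * r ^+ 2)^-1.
have c0 : 0 < c by rewrite invr_gt0 mulr_gt0// exprn_gt0.
have A0 : (0 <= nnint mu (fun x => o x ^+ 2)%R)%E by apply: nnint_ge0 => x; exact: sqr_ge0.
have B0 : (0 <= nnint mu (fun x => W (v x)))%E by apply: nnint_ge0 => x; exact: (dw_ge0 dW).
rewrite -/c; have [Aoo|Afin] := eqVneq (nnint mu (fun x => o x ^+ 2)%R) +oo%E.
  rewrite Aoo gt0_muley ?lte_fin// addye ?leey//.
  by apply/eqP => BN; rewrite BN in B0.
have [Boo|Bfin] := eqVneq (nnint mu (fun x => W (v x))) +oo%E.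
  rewrite Boo addey ?leey//; apply/eqP => AN.
  have : (0 <= c%:E * nnint mu (fun x => o x ^+ 2)%R)%E.
    by apply: mule_ge0 => //; rewrite lee_fin ltW.
  by rewrite AN.
have [a aE] : exists a, nnint mu (fun x => o x ^+ 2)%R = a%:E.
  by exists (fine (nnint mu (fun x => o x ^+ 2)%R)); rewrite fineK// ge0_fin_numE// ltey.
have [b bE] : exists b, nnint mu (fun x => W (v x)) = b%:E.
  by exists (fine (nnint mu (fun x => W (v x)))); rewrite fineK// ge0_fin_numE// ltey.
have a0 : 0 <= a by rewrite -lee_fin -aE.
rewrite aE bE; apply/lee_addgt0Pr => e e0.
(* With [k = 1 / (1 + d)] and [d <= 1] the factor [k ^- 2] is at most [1 + 3 * d], so this [d] costs
   at most [e / 2]; the [+ 1] avoids a division by zero. The other half of [e] is left to the step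
   [N%:R^-1]. *)
pose d := Num.min 1 (e / 2 / (3 * (c * a) + 1)).
have ca0 : 0 <= c * a by rewrite mulr_ge0// ltW.
have q0 : 0 < 3 * (c * a) + 1 by lra.
have d0 : 0 < d by rewrite lt_min ltr01 divr_gt0// divr_gt0.
have d1 : d <= 1 by rewrite ge_min lexx.
have dce : 3 * (c * a) * d <= e / 2.
  apply: (@le_trans _ _ ((3 * (c * a) + 1) * d)); first by rewrite ler_wpM2r// ?(ltW d0)//; lra.
  by rewrite mulrC -ler_pdivlMr// ge_min lexx orbT.
pose k := (1 + d)^-1.
have k01 : 0 < k < 1 by rewrite invr_gt0 invf_lt1; lra.
have [L L0 [vL vL']] := tails _ k01.
pose Q := c * (8 * (2 * L + 2 * r)).
have Q0 : 0 <= Q by rewrite !mulr_ge0//; [exact: ltW|lra].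
pose N := (Num.truncn (Q / (e / 2))).+1.
have N0 : 0 < N%:R :> R by rewrite ltr0n.
have hN : N%:R^-1 * N%:R = 1 :> R by rewrite mulVf// gt_eqF.
have Qh : Q * N%:R^-1 <= e / 2.
  rewrite ler_pdivrMr// mulrC -ler_pdivrMr; last by lra.
  by rewrite ltW// truncnS_gt.
have [w [aw w1 w2]] := step_comparison dW r0 k01 L0 (ltn0Sn _) hN mv no ho vL vL'.
apply: (le_trans (umin _ aw)); rewrite increment_energyE// -/c.
apply: (@le_trans _ _ (c%:E * (k ^- 2 * a + 8 * N%:R^-1 * (2 * L + 2 * r))%:E + b%:E)%E).
  apply: leeD; last by rewrite -bE.
  apply: lee_wpmul2l; first by rewrite lee_fin ltW.
  by rewrite EFinD EFinM -aE.
rewrite -!EFinM -!EFinD lee_fin.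
have -> : c * (k ^- 2 * a + 8 * N%:R^-1 * (2 * L + 2 * r)) =
    k ^- 2 * (c * a) + Q * N%:R^-1 by rewrite /Q; ring.
have k2 : k ^- 2 = (1 + d) ^+ 2 by rewrite /k exprVn invrK.
have : (1 + d) ^+ 2 * (c * a) <= (1 + 3 * d) * (c * a).
  rewrite ler_wpM2r//; have : d * d <= d * 1 by rewrite ler_wpM2l// ltW.
  rewrite sqrrD; lra.
have -> : (1 + 3 * d) * (c * a) = c * a + 3 * (c * a) * d by ring.
rewrite -k2; lra.
Qed.

End minimality.

(** * Covers, nullity and simple functions *)

Section leb_approximation.
Context {R : realType}.
Notation mu := (@leb R).
Notation T := (@leb_type R).
Implicit Types (A E : set T).
Lemma leb_cover_le A (a b : nat -> R) (s : R) : (forall n, a n <= b n) ->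
  (forall x, A x -> exists n, a n < x < b n) ->
  (forall N, \sum_(0 <= n < N) (b n - a n) <= s) -> (mu A <= s%:E)%E.
Proof.
move=> ab Aab sums; pose F n : set T := `]a n, b n[%classic.
have mF n : measurable (F n) by exact: itv_leb_measurable.
have muF n : mu (F n) = (b n - a n)%:E.
  rewrite /F leb_itv /= lte_fin; move: (ab n); rewrite le_eqVlt => /predU1P[->|->].
    by rewrite ltxx subrr.
  by rewrite -EFinB.
apply: (@le_trans _ _ (mu (\bigcup_n F n))).
  by apply: leb_le => x /Aab[n xn]; exists n => //; rewrite /F /= in_itv.
apply: (@le_trans _ _ (\sum_(0 <= n <oo) mu (F n))%E).
  apply: measure_sigma_subadditive; [exact: mF| |by []].
  by apply: bigcupT_measurable; exact: mF.
apply: lime_le.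
  by apply: is_cvg_nneseries => n _ _; exact: measure_ge0.
apply: nearW => N.
rewrite (eq_bigr (fun n => (b n - a n)%:E)); last by move=> n _; exact: muF.
by rewrite sumEFin lee_fin.
Qed.
Lemma leb_cover_ex A (t : R) : (mu A < t%:E)%E -> exists a b : nat -> R,
  [/\ forall n, a n <= b n, forall x, A x -> exists n, a n < x < b n &
      forall N, \sum_(0 <= n < N) (b n - a n) <= t].
Proof.
rewrite (_ : mu A = ((@wlength R idfun)^* A)%mu)// outer_measure_open_itv_cover.
move=> /ereal_inf_lt[_ [F [Fitv AF] <-] sumF].
have [e eE] := choice Fitv.
(* An interval of the given cover may be empty with reversed endpoints; the maximum restores their
   order. *)
exists (fun n => (e n).1), (fun n => Num.max (e n).1 (e n).2); split.
- by move=> n; rewrite le_max lexx.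
- move=> x /AF[n _]; rewrite eE /= in_itv/= => /andP[h1 h2]; exists n.
  by rewrite h1 lt_max h2 orbT.
- move=> N; rewrite -lee_fin -sumEFin; apply: le_trans (ltW sumF).
  apply: le_trans (nneseries_lim_ge N _); last by move=> n _ _; exact: wlength_ge0.
  apply: lee_sum => n _; rewrite eE wlength_itv /= lte_fin.
  case: ltP => h; first by rewrite -EFinB.
  by rewrite subrr.
Qed.
(** The intersection [D] of the approximating open sets exceeds [E] by a null set, which is
    measurable by completeness. *)
Lemma measurable_of_open_approx E :
  (forall e : R, 0 < e -> exists G : set R,
     [/\ open G, (E : set R) `<=` G & (mu ((G : set T) `\` E) <= e%:E)%E]) -> measurable E.
Proof.
move=> h; have i0 (n : nat) : 0 < n.+1%:R^-1 :> R by rewrite invr_gt0.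
have [G GP] := choice (fun n => h _ (i0 n)).
pose D : set T := \bigcap_n (G n : set T).
have mD : measurable D.
  by apply: bigcapT_measurable => n; have [oG _ _] := GP n; exact: open_leb_measurable.
have D0 : mu (D `\` E) = 0%E.
  apply/eqP; rewrite eq_le measure_ge0 andbT; apply/lee_addgt0Pr => e e0; rewrite add0e.
  have [n ne] : exists n : nat, n.+1%:R^-1 < e.
    by have [n _ /(_ n (leqnn n)) ?] := near_infty_natSinv_lt (PosNum e0); exists n.
  have [_ _ Ge] := GP n; apply: (@le_trans _ _ (n.+1%:R^-1)%:E); last by rewrite lee_fin ltW.
  by apply: le_trans Ge; apply: leb_le => x [Dx Ex]; split => //; exact: Dx.
rewrite (_ : E = D `\` (D `\` E)); first by apply: measurableD => //; exact: leb_eq0_measurable.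
apply/seteqP; split => x /=.
  by move=> Ex; split; [move=> n _; have [_ EG _] := GP n; exact: EG|case].
by move=> [Dx nDE]; apply: contrapT => Ex; apply: nDE.
Qed.
Lemma open_approx_of_measurable E (e : R) : measurable E -> (mu E < +oo)%E -> 0 < e ->
  exists G : set R, [/\ open G, (E : set R) `<=` G & (mu ((G : set T) `\` E) <= e%:E)%E].
Proof.
move=> mE Efin e0; have [G [oG EG GE]] := outer_measure_open_le (E : set R) e0.
exists G; split => //.
have mG : measurable (G : set T) by exact: open_leb_measurable.
have GE' : (mu (G : set T) <= mu E + e%:E)%E by exact: GE.
have Efin' : mu E \is a fin_num by rewrite ge0_fin_numE ?measure_ge0.
have Gsplit : mu (G : set T) = (mu E + mu ((G : set T) `\` E))%E.
  rewrite -measureU; [|exact: mE|exact: measurableD|].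
  - by congr (mu _); rewrite setDUK.
  - by rewrite setDIK.
by move: GE'; rewrite Gsplit leeD2lE.
Qed.
Lemma cvg_nnint_window f : nn_mfun f ->
  (fun n : nat => nnint mu (fun x : T => f x * \1_(`]- n%:R, n%:R[%classic : set T) x)) @ \oo -->
  nnint mu f.
Proof.
move=> nf; pose J n : set T := `]- n%:R, n%:R[%classic.
have nJ n : nn_mfun (fun x : T => f x * \1_(J n) x).
  by apply: nn_mfun_mul => //; apply: nn_mfun_indic; exact: itv_leb_measurable.
have -> : nnint mu f = (\int[mu]_x (limn (fun n => (f x * \1_(J n) x)%:E)))%E.
  apply: eq_integral => x _; apply/esym/cvg_lim => //; apply: cvg_near_cst.
  exists (Num.truncn `|x : R|).+1 => // n /= xn.
  have xn' : `|x : R| < n%:R by apply: (lt_le_trans (truncnS_gt _)); rewrite ler_nat.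
  rewrite indicE mem_set ?mulr1//; rewrite /J /= in_itv/=.
  by move: xn'; rewrite ltr_norml.
apply: cvg_monotone_convergence => //.
- by move=> n; apply/measurable_EFinP; exact: (nJ n).2.
- by move=> n x _; rewrite lee_fin; exact: (nJ n).1.
- move=> x _ m n mn; rewrite lee_fin; apply: ler_wpM2l; first exact: nf.1.
  rewrite !indicE ler_nat; have [Jm|Jm] := pselect (J m x); last by rewrite memNset.
  rewrite mem_set// (mem_set (A := J n))//; move: Jm; rewrite /J /= !in_itv/=.
  have : m%:R <= n%:R :> R by rewrite ler_nat.
  by move=> mn' /andP[? ?]; apply/andP; split; lra.
Qed.
Import HBSimple HBNNSimple.
Lemma nnint_simple_approx d (X : measurableType d) (nu : {measure set X -> \bar R})
    (f : X -> R) (t : R) : nn_mfun f -> (t%:E < nnint nu f)%E ->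
  exists (h : X -> R) (s : seq R),
  [/\ forall x, 0 <= h x <= f x, forall y, measurable (h @^-1` [set y]),
      forall x, h x = \sum_(y <- s) y * \1_(h @^-1` [set y]) x &
      (t%:E < \sum_(y <- s) y%:E * nu (h @^-1` [set y]))%E].
Proof.
move=> nf; rewrite /nnint ge0_integralTE//; last by move=> x; rewrite lee_fin; exact: nf.1.
move=> /ereal_sup_gt[_ [h hg <-]]; rewrite sintegralE fsbig_finite//= => th.
exists h, (finmap.enum_fset (fset_set (range h))); split => //.
- by move=> x; rewrite fun_ge0 /=; have := hg x; rewrite lee_fin.
- by move=> x; rewrite fimfunE fsbig_finite.
Qed.
(** Truncating [f] to a bounded window first gives the level sets of the simple function a finite
    measure, as the triples of [simple_below] require. *)
Lemma nnint_simple_lt f (t : R) : nn_mfun f -> (t%:E < nnint mu f)%E ->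
  exists l : seq (R * set T * R),
  [/\ forall c E m, List.In (c, E, m) l -> [/\ 0 <= c, measurable E & mu E = m%:E],
      forall x, foldr (fun p acc => p.1.1 * \1_(p.1.2) x + acc) 0 l <= f x &
      t <= foldr (fun p acc => p.1.1 * p.2 + acc) 0 l].
Proof.
move=> nf tf.
have [n tn] : exists n : nat,
    (t%:E < nnint mu (fun x : T => f x * \1_(`]- n%:R, n%:R[%classic : set T) x)%R)%E.
  apply: contrapT => /forallNP h; move: tf; apply/negP; rewrite -leNgt.
  apply: (cvge_le _ (cvg_nnint_window nf)); apply: nearW => n.
  by rewrite leNgt; apply/negP; exact: h.
pose J : set T := `]- n%:R, n%:R[%classic.
have mJ : measurable J by exact: itv_leb_measurable.
have Jfin : (mu J < +oo)%E.
  by rewrite /J leb_itv /=; case: ifP => _; rewrite ?ltry// -EFinB ltry.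
have ng : nn_mfun (fun x : T => f x * \1_J x).
  by apply: nn_mfun_mul => //; exact: nn_mfun_indic.
have [h [s0 [h0f mh hE th]]] := nnint_simple_approx ng tn.
have h0 x : 0 <= h x by have /andP[] := h0f x.
have hf x : h x <= f x * \1_J x by have /andP[] := h0f x.
have build (s : seq R) : exists l : seq (R * set T * R),
  [/\ forall c E m, List.In (c, E, m) l -> [/\ 0 <= c, measurable E & mu E = m%:E],
      forall x, foldr (fun p acc => p.1.1 * \1_(p.1.2) x + acc) 0 l =
        \sum_(y <- s) y * \1_(h @^-1` [set y]) x &
      (foldr (fun p acc => p.1.1 * p.2 + acc) 0 l)%:E =
        (\sum_(y <- s) y%:E * mu (h @^-1` [set y]))%E].
  elim: s => [|y s [l [l1 l2 l3]]].
    by exists [::]; split => //= [x|]; rewrite big_nil.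
  (* Values that are not positive contribute nothing and are dropped; the level set of [0] may have
     infinite measure. *)
  have [y0|y0] := ltP 0 y; last first.
    exists l; split => // [x|]; rewrite big_cons.
      rewrite l2 (_ : y * _ = 0) ?add0r//; move: y0; rewrite le_eqVlt => /predU1P[->|y0].
        by rewrite mul0r.
      rewrite indicE memNset ?mulr0// => /= hy; have := h0 x.
      by rewrite hy leNgt y0.
    rewrite l3 (_ : (_ * _)%E = 0%E) ?add0e//; move: y0; rewrite le_eqVlt => /predU1P[->|y0].
      by rewrite mul0e.
    rewrite (_ : _ @^-1` _ = set0) ?measure0 ?mule0//; apply/seteqP; split => // x /= hy.
    by have := h0 x; rewrite hy leNgt y0.
  have yfin : mu (h @^-1` [set y]) = (fine (mu (h @^-1` [set y])))%:E.
    rewrite fineK// ge0_fin_numE ?measure_ge0//; apply: le_lt_trans Jfin.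
    apply: leb_le => x /= hy; apply: contrapT => Jx; have := hf x.
    by rewrite hy indicE memNset// mulr0 leNgt y0.
  exists ((y, h @^-1` [set y], fine (mu (h @^-1` [set y]))) :: l); split.
  - move=> c E m /= [[<- <- <-]|]; last exact: l1.
    by split => //; exact: ltW.
  - by move=> x /=; rewrite big_cons l2.
  - by rewrite /= big_cons EFinD EFinM -yfin l3.
have [l [l1 l2 l3]] := build s0.
exists l; split => //.
  move=> x; rewrite l2; apply: (@le_trans _ _ (h x)).
    by rewrite -hE.
  apply: (le_trans (hf x)); apply: ler_piMr; first exact: nf.1.
  by rewrite indicE lern1; case: (_ \in _).
by rewrite -lee_fin l3; exact: ltW.
Qed.
Definition leb_mfun (f : T -> R) := measurable_fun setT f.
Lemma leb_mfun_lt (f : T -> R) (t : R) : leb_mfun f -> measurable [set x : T | f x < t].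
Proof.
move=> mf; rewrite (_ : [set x | _] = setT `&` f @^-1` `]-oo, t[); last first.
  by rewrite setTI; apply/seteqP; split=> x /=; rewrite in_itv.
by apply: mf; [exact: measurableT|exact: measurable_itv].
Qed.
End leb_approximation.

From mathcomp Require Import Rstruct Rstruct_topology.
Import Pilot.Defs.
Local Open Scope ring_scope.

(** * The energy as a Lebesgue integral *)

Notation RR := Rdefinitions.R.
Notation lebR A := (@leb RR (A : set (@leb_type RR))).

Definition ER_ereal (x : ER) : \bar RR := if x is Fin a then a%:E else +oo%E.

Definition leb_nn (f : RR -> RR) := nn_mfun (f : @leb_type RR -> RR).
Definition leb_int (f : RR -> RR) : \bar RR := nnint (@leb RR) (f : @leb_type RR -> RR).
Lemma cover_sum_leb (A : set RR) s : cover_sum A s -> (lebR A <= s%:E)%E.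
Proof.
move=> [a [b [ab [Aab cv]]]]; apply: (@leb_cover_le RR _ a b).
- by move=> n; apply/RleP.
- by move=> x /Aab[n [/RltP h1 /RltP h2]]; exists n; apply/andP; split.
- case=> [|N].
    rewrite big_geq//; apply/RleP.
    have gr : Un_growing (fun N => sum_f_R0 (fun n => (b n - a n)%coqR) N).
      by move=> n; have /RleP := ab n.+1 => h; apply/RleP; rewrite /= lerDl subr_ge0.
    have := growing_ineq _ _ gr cv 0%N => /= h; apply: Rle_trans h.
    by have /RleP := ab 0%N => h; apply/RleP; rewrite subr_ge0.
  have gr : Un_growing (fun N => sum_f_R0 (fun n => (b n - a n)%coqR) N).
    by move=> n; have /RleP := ab n.+1 => h; apply/RleP; rewrite /= lerDl subr_ge0.
  by have /RleP := growing_ineq _ _ gr cv N; rewrite sum_f_R0E.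
Qed.
Lemma leb_cover_sum (A : set RR) (t : RR) : (lebR A < t%:E)%E ->
  exists s, cover_sum A s /\ Rle s t.
Proof.
move=> /(@leb_cover_ex RR)[a [b [ab Aab sums]]].
pose S N := sum_f_R0 (fun n => (b n - a n)%coqR) N.
have gr : Un_growing S by move=> n; apply/RleP; rewrite /S /= lerDl subr_ge0.
have St N : Rle (S N) t by apply/RleP; rewrite /S sum_f_R0E.
have ubS : has_ub S by exists t => x [n ->]; exact: St.
have [s cv] := growing_cv _ gr ubS.
exists s; split.
  exists a, b; split; first by move=> n; apply/RleP.
  split => // x Ax; have [n /andP[/RltP h1 /RltP h2]] := Aab x Ax.
  by exists n.
have ct : Un_cv (fun=> t) t.
  by move=> eps eps0; exists 0%N => n _; rewrite /Rdist Rminus_diag Rabs_R0.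
exact: (Rle_cv_lim St cv ct).
Qed.
Lemma nullP (A : set RR) : null A <-> lebR A = 0%E.
Proof.
split=> [h|A0 eps /RltP eps0].
  apply/eqP; rewrite eq_le measure_ge0 andbT; apply/lee_addgt0Pr => e /RltP e0.
  rewrite add0e; have [s [cs /RleP se]] := h _ e0.
  by apply: (le_trans (cover_sum_leb cs)); rewrite lee_fin.
by apply: leb_cover_sum; rewrite A0 lte_fin.
Qed.
Lemma open_setP (G : set RR) : open_set G <-> open G.
Proof.
split=> [h|oG x Gx].
  rewrite openE => x /h[d dG]; exists (pos d) => /=.
    by apply/RltP; exact: cond_pos.
  move=> y /= xy; apply: dG; rewrite /disc; apply/RltP.
  by rewrite RabsE -normrN opprB.
move: oG; rewrite openE => /(_ x Gx)[d /= /RltP d0 dG].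
exists (mkposreal d d0) => y; rewrite /disc /= => /RltP xy; apply: dG => /=.
by move: xy; rewrite RabsE -normrN opprB.
Qed.
Lemma measurable_set_leb (E : set RR) : measurable_set E ->
  measurable (E : set (@leb_type RR)).
Proof.
move=> h; apply: (@measurable_of_open_approx RR) => e /RltP e0.
have [G [/open_setP oG [EG [s [cs /RleP se]]]]] := h _ e0.
exists G; split => //; apply: le_trans (_ : s%:E <= _)%E; last by rewrite lee_fin.
exact: (cover_sum_leb cs).
Qed.
Lemma open_approx_measurable_set (E : set RR) :
  (forall e : RR, 0 < e -> exists G : set RR,
     [/\ open G, E `<=` G & (lebR (G `\` E) <= e%:E)%E]) -> measurable_set E.
Proof.
move=> h eps /RltP eps0; have e20 : 0 < eps / 2 by apply: divr_gt0.
have [G [oG EG GE]] := h _ e20; exists G; split; first exact/open_setP.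
split => //; apply: leb_cover_sum; apply: le_lt_trans GE _.
by rewrite lte_fin ltr_pdivrMr// ltr_pMr// ltr1n.
Qed.
Lemma leb_measurable_set (E : set RR) : measurable (E : set (@leb_type RR)) ->
  (lebR E < +oo)%E -> measurable_set E.
Proof.
move=> mE Efin; apply: open_approx_measurable_set => e e0.
exact: (@open_approx_of_measurable RR).
Qed.
(** Superlevel sets of nondecreasing functions can have infinite measure, so [leb_measurable_set]
    does not reach them. Extending an up-set to the left by [d] makes it open, and the added points
    lie within [d] of each other. *)
Lemma upset_measurable_set (E : set RR) : (forall x y, x <= y -> E x -> E y) ->
  measurable_set E.
Proof.
move=> up; apply: open_approx_measurable_set => e e0.
pose d := e / 4; have d0 : 0 < d by rewrite /d; lra.
pose G : set RR := [set x | exists2 y, E y & y - d < x].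
have oG : open G.
  have -> : G = \bigcup_(y in E) `]y - d, +oo[%classic.
    apply/seteqP; split => x [y Ey yx]; exists y => //.
      by rewrite /= in_itv/= yx.
    by move: yx; rewrite /= in_itv/= andbT.
  by apply: bigcup_open => y _; exact: interval_open.
exists G; split => //.
  by move=> x Ex; exists x => //; rewrite ltrBlDr ltrDl.
have [[x0 [[y0 Ey0 yx0] nE0]]|none] := pselect (exists x, (G `\` E) x); last first.
  rewrite (_ : G `\` E = set0) ?measure0 ?lee_fin ?ltW//.
  by apply/seteqP; split => // x Gx; apply: none; exists x.
have lt_E x y : ~ E x -> E y -> x < y.
  by move=> nEx Ey; rewrite ltNge; apply/negP => yx; apply: nEx; exact: up Ey.
apply: (@le_trans _ _ (lebR `]x0 - d, x0 + d[%classic)).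
  apply: leb_le => x [[y Ey yx] nEx]; rewrite /= in_itv/=; apply/andP; split.
    by have := lt_E _ _ nE0 Ey; lra.
  by have := lt_E _ _ nEx Ey0; lra.
rewrite (@leb_itv RR) /= lte_fin; case: ifP => _; last by rewrite lee_fin ltW.
by rewrite -EFinB lee_fin /d; lra.
Qed.
Lemma outer_isP (E : set RR) (m : RR) : outer_is E m <-> lebR E = m%:E.
Proof.
split=> [[lb glb]|Em].
  have low (t : RR) : (t%:E <= lebR E)%E -> t <= m.
    move=> tE; apply/RleP; apply: glb => s /cover_sum_leb Es; apply/RleP.
    by rewrite -lee_fin; exact: le_trans Es.
  apply/eqP; rewrite eq_le; apply/andP; split; last first.
    rewrite leNgt; apply/negP => Em.
    have [v Ev vm] : exists2 v : RR, lebR E = v%:E & v < m.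
      have fin : lebR E \is a fin_num.
        by rewrite ge0_fin_numE ?measure_ge0// (lt_trans Em)// ltry.
      by exists (fine (lebR E)); rewrite ?fineK// -lte_fin fineK.
    pose q : RR := (v + m) / 2.
    have [vq qm] := midf_lt vm; rewrite -/q in vq qm.
    have [s [cs /RleP sv]] : exists s, cover_sum E s /\ Rle s q.
      by apply: leb_cover_sum; rewrite Ev lte_fin.
    have /RleP ms := lb _ cs.
    by have := le_lt_trans (le_trans ms sv) qm; rewrite ltxx.
  case Ev : (lebR E) => [v||].
  - by rewrite lee_fin; apply: low; rewrite Ev.
  (* If the measure were infinite, every real number would be a lower bound for the cover sums, even
     [m + 1]. *)
  - by have := low (m + 1); rewrite Ev leey => /(_ isT); rewrite gerDl ler10.
  - by exact: leNye.
split=> [s /cover_sum_leb|m' h].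
  by rewrite Em lee_fin => /RleP.
apply/RleP/ler_addgt0Pr => e e0.
pose q : RR := m + e.
have [s [cs /RleP se]] : exists s, cover_sum E s /\ Rle s q.
  by apply: leb_cover_sum; rewrite Em lte_fin /q ltrDl.
by have /RleP ms := h _ cs; exact: le_trans se.
Qed.
Lemma indicR (E : set RR) (c x : RR) : Defs.indic E c x = c * \1_(E : set (@leb_type RR)) x.
Proof.
rewrite /Defs.indic indicE; case: excluded_middle_informative => Ex.
  by rewrite mem_set// mulr1.
by rewrite memNset// mulr0.
Qed.
Lemma simple_below_le (f : RR -> RR) s : leb_nn f -> simple_below f s -> (s%:E <= leb_int f)%E.
Proof.
move=> nf [l [lP [lf ->]]].
suff [ng gE] : leb_nn (fun x => List.fold_right
    (fun t acc => Defs.indic (snd (fst t)) (fst (fst t)) x + acc) 0 l) /\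
    leb_int (fun x => List.fold_right
    (fun t acc => Defs.indic (snd (fst t)) (fst (fst t)) x + acc) 0 l) =
    (List.fold_right (fun t acc => fst (fst t) * snd t + acc) 0 l)%:E.
  by rewrite -[leLHS]gE; apply: (nnint_le (@leb RR) ng nf) => x; apply/RleP; exact: lf.
elim: l lP {lf} => [|[[c E] m] l IH] lP /=.
  split; first exact: nn_mfun_cst.
  by rewrite /leb_int /nnint; apply: integral0_eq.
have [|ng gE] := IH; first by move=> c' E' m' h; apply: lP; right.
have [/RleP c0 [/measurable_set_leb mE /outer_isP Em]] := lP c E m (or_introl erefl).
have nE := nn_mfun_indic (R := RR) mE.
have ncE := nn_mfun_scale nE c0.
have -> : (fun x : RR => Defs.indic E c x + List.fold_right
    (fun t acc => Defs.indic (snd (fst t)) (fst (fst t)) x + acc) 0 l) =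
    (fun x : RR => c * \1_(E : set (@leb_type RR)) x + List.fold_right
    (fun t acc => Defs.indic (snd (fst t)) (fst (fst t)) x + acc) 0 l).
  by apply/funext => x; rewrite indicR.
split; first exact: (nn_mfun_add ncE ng).
rewrite /leb_int (nnint_add (@leb RR) ncE ng) (nnint_scale (@leb RR) nE c0).
by rewrite (nnint_indic (@leb RR) mE) [X in (_ + X)%E]gE Em.
Qed.
Lemma simple_below_lt (f : RR -> RR) (t : RR) : leb_nn f -> (t%:E < leb_int f)%E ->
  exists s, simple_below f s /\ t <= s.
Proof.
move=> nf /(nnint_simple_lt nf)[l [l1 l2 l3]].
exists (foldr (fun p acc => p.1.1 * p.2 + acc) 0 l); split => //.
exists l; split.
  move=> c E m /l1[c0 mE Em]; split; first exact/RleP.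
  split; last exact/outer_isP.
  by apply: leb_measurable_set => //; rewrite Em ltry.
split => // x; apply/RleP; apply: le_trans (l2 x).
rewrite le_eqVlt; apply/orP; left; apply/eqP.
by elim: l {l1 l2 l3} => //= p l ->; rewrite indicR.
Qed.
Lemma Rsup_is_lub (S : RR -> Prop) : bound S -> (exists x, S x) -> is_lub S (Rsup S).
Proof.
move=> bS nS; rewrite /Rsup; case: excluded_middle_informative => [h|]; last by case.
by case: completeness.
Qed.
Lemma ER_ereal_integral (f : RR -> RR) : leb_nn f ->
  ER_ereal (Defs.integral f) = leb_int f.
Proof.
move=> nf; rewrite /Defs.integral /ER_sup; case: excluded_middle_informative => bS /=.
  have neS : exists s, simple_below f s.
    exists 0; exists nil; split => //; split => // x.
    by apply/RleP; exact: nf.1.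
  have [ub lub] := Rsup_is_lub bS neS.
  apply/eqP; rewrite eq_le; apply/andP; split.
    rewrite leNgt; apply/negP => h.
    have fin : leb_int f \is a fin_num.
      by rewrite ge0_fin_numE ?(lt_trans h) ?ltry//; exact: nnint_ge0 nf.1.
    move: h; rewrite -(fineK fin) lte_fin => /RltP h.
    apply: (Rlt_not_le _ _ h); apply: lub => s hs; apply/RleP.
    by rewrite -lee_fin fineK//; exact: simple_below_le.
  rewrite leNgt; apply/negP => h.
  have [t ht1 ht2] : exists2 t : RR, Rsup (simple_below f) < t & (t%:E < leb_int f)%E.
    case E : (leb_int f) h => [v| |] //.
      rewrite lte_fin => h; exists ((Rsup (simple_below f) + v) / 2); rewrite ?lte_fin; lra.
    by move=> _; exists (Rsup (simple_below f) + 1); [rewrite ltrDl|exact: ltry].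
  have [s [hs ts]] := simple_below_lt nf ht2.
  by have /RleP := ub _ hs; rewrite leNgt (lt_le_trans ht1 ts).
apply/esym/eqP; rewrite -leye_eq leNgt; apply/negP => h; apply: bS.
have fin : leb_int f \is a fin_num.
  by rewrite ge0_fin_numE//; exact: nnint_ge0 nf.1.
exists (fine (leb_int f)) => s hs; apply/RleP.
by rewrite -lee_fin fineK//; exact: simple_below_le.
Qed.
Lemma ER_leP (x y : ER) : ER_le x y <-> (ER_ereal x <= ER_ereal y)%E.
Proof.
case: x y => [a|] [b|] /=; rewrite ?lee_fin ?leey ?leye_eq//.
by split => /RleP.
Qed.
Lemma ER_ereal_plus (x y : ER) : ER_ereal (ER_plus x y) = (ER_ereal x + ER_ereal y)%E.
Proof. by case: x y => [a|] [b|]. Qed.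

(** * Essential oscillation *)

Section oscillation.
Implicit Types (u v : RR -> RR) (c d x r M : RR).

(** Under this condition the sets inside [ess_sup] and [ess_inf] are bounded and nonempty on a
    nondegenerate interval, so the default value [0] of [Rsup] does not enter. *)
Definition ess_bounded c d v := exists M : RR, null (fun x => Rlt c x /\ Rlt x d /\ Rlt M (Rabs (v x))).
Lemma null_sub (A B : set RR) : A `<=` B -> null B -> null A.
Proof.
move=> AB /nullP B0; apply/nullP; apply/eqP; rewrite eq_le measure_ge0 andbT -B0.
exact: (@leb_le RR).
Qed.
Lemma null_setU (A B : set RR) : null A -> null B -> null (A `|` B).
Proof.
move=> /nullP A0 /nullP B0; apply/nullP; apply/eqP; rewrite eq_le measure_ge0 andbT.
have mA := leb_eq0_measurable (R := RR) A0; have mB := leb_eq0_measurable (R := RR) B0.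
by apply: le_trans (leb_setU mA mB) _; rewrite A0 B0 adde0.
Qed.
Lemma not_null_itv c d (A B : set RR) : c < d ->
  (forall x, c < x -> x < d -> A x \/ B x) -> null A -> null B -> False.
Proof.
move=> cd cov nA nB.
have /nullP : null (`]c, d[%classic : set RR).
  apply: null_sub (null_setU nA nB) => x; rewrite /= in_itv/= => /andP[? ?].
  exact: cov.
rewrite (@leb_itv RR) /= lte_fin cd -EFinB => /eqP; rewrite eqe subr_eq0 => /eqP h.
by move: cd; rewrite h ltxx.
Qed.
Definition above c d v M : set RR := fun x => (Rlt c x /\ Rlt x d) /\ Rlt M (v x).
Definition below c d v M : set RR := fun x => (Rlt c x /\ Rlt x d) /\ Rlt (v x) M.

Lemma ess_sup_spec c d v : c < d -> ess_bounded c d v ->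
  (forall M, null (above c d v M) -> ess_sup c d v <= M) /\
  (forall M, ~ null (above c d v M) -> M <= ess_sup c d v).
Proof.
move=> cd [K nK].
pose S : RR -> Prop := fun y => null (fun x => Rlt c x /\ Rlt x d /\ Rlt (Ropp y) (v x)).
pose S' : RR -> Prop := fun y => null (fun x => (Rlt c x /\ Rlt x d) /\ Rlt (Ropp y) (v x)).
have bS : bound S'.
  exists (K + 1) => y Sy; apply: Rnot_lt_le => /RltP yK.
  apply: (not_null_itv cd _ Sy nK) => x /RltP xc /RltP xd.
  have [h|h] := ltP (- y) (v x); first by left; split => //; apply/RltP.
  right; split => //; split => //; apply/RltP; rewrite RabsE lter_normr; apply/orP; right.
  by lra.
have neS : exists y, S' y.
  exists (- K); apply: null_sub nK => x [[? ?] /RltP h]; split => //; split => //.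
  apply/RltP; rewrite RabsE lter_normr; apply/orP; left.
  by move: h; rewrite RoppE opprK.
have [ub lub] := Rsup_is_lub bS neS.
split=> M h.
  rewrite /ess_sup RoppE lerNl; apply/RleP; apply: ub.
  by apply: null_sub h => x [? /RltP hx]; split => //; apply/RltP; move: hx; rewrite RoppE opprK.
rewrite /ess_sup RoppE lerNr; apply/RleP; apply: lub => y Sy; apply: Rnot_lt_le => /RltP My.
apply: h; apply: null_sub Sy => x [? /RltP hx]; split => //; apply/RltP.
by rewrite RoppE; move: My hx; rewrite ltrNl => /ltW /le_lt_trans; apply.
Qed.
Lemma ess_inf_spec c d v : c < d -> ess_bounded c d v ->
  (forall M, null (below c d v M) -> M <= ess_inf c d v) /\
  (forall M, ~ null (below c d v M) -> ess_inf c d v <= M).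
Proof.
move=> cd [K nK].
pose S' : RR -> Prop := fun m => null (fun x => (Rlt c x /\ Rlt x d) /\ Rlt (v x) m).
have bS : bound S'.
  exists (K + 1) => y Sy; apply: Rnot_lt_le => /RltP yK.
  apply: (not_null_itv cd _ Sy nK) => x /RltP xc /RltP xd.
  have [h|h] := ltP (v x) y; first by left; split => //; apply/RltP.
  right; split => //; split => //; apply/RltP; rewrite RabsE lter_normr; apply/orP; left.
  by lra.
have neS : exists y, S' y.
  exists (- K); apply: null_sub nK => x [[? ?] /RltP h]; split => //; split => //.
  apply/RltP; rewrite RabsE lter_normr; apply/orP; right.
  by move: h; rewrite ltrNr.
have [ub lub] := Rsup_is_lub bS neS.
split=> M h; first by apply/RleP; exact: ub.
apply/RleP; apply: lub => y Sy; apply: Rnot_lt_le => /RltP My.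
apply: h; apply: null_sub Sy => x [? /RltP hx]; split => //; apply/RltP.
exact: lt_trans My.
Qed.
Lemma osc_ge c d v M m : c < d -> ess_bounded c d v ->
  ~ null (above c d v M) -> ~ null (below c d v m) -> M - m <= osc c d v.
Proof.
move=> cd bv /(proj2 (ess_sup_spec cd bv)) h1 /(proj2 (ess_inf_spec cd bv)) h2.
by rewrite /osc RminusE lerB.
Qed.
Lemma osc_gt c d v (t : RR) : c < d -> ess_bounded c d v -> t < osc c d v ->
  exists M m : RR, [/\ t < M - m, ~ null (above c d v M) & ~ null (below c d v m)].
Proof.
move=> cd bv; have [s1 _] := ess_sup_spec cd bv; have [i1 _] := ess_inf_spec cd bv.
(* A third of the excess over [t]: both ends give up [q] and one [q] remains. *)
rewrite /osc RminusE => h; pose q := (ess_sup c d v - ess_inf c d v - t) / 3.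
have q0 : 0 < q by rewrite /q; lra.
exists (ess_sup c d v - q), (ess_inf c d v + q); split; first by rewrite /q; lra.
- by move=> /s1; lra.
- by move=> /i1; lra.
Qed.
Lemma osc_ge0 c d v : c < d -> ess_bounded c d v -> 0 <= osc c d v.
Proof.
move=> cd bv; have [s1 s2] := ess_sup_spec cd bv; have [i1 i2] := ess_inf_spec cd bv.
rewrite /osc RminusE subr_ge0 leNgt; apply/negP => h.
(* If the supremum were below the infimum, two levels [M < m] would fit between them, and every
   point would be above [M] or below [m]. *)
pose M := ess_sup c d v + (ess_inf c d v - ess_sup c d v) / 3.
pose m := ess_sup c d v + (ess_inf c d v - ess_sup c d v) / 2.
have hM : null (above c d v M) by apply: contrapT => /s2; rewrite /M; lra.
have hm : null (below c d v m) by apply: contrapT => /i2; rewrite /m; lra.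
apply: (not_null_itv cd _ hM hm) => x /RltP xc /RltP xd.
have Mm : M < m by rewrite /M /m; lra.
by have [hx|hx] := ltP M (v x); [left|right]; split => //; apply/RltP => //; exact: le_lt_trans Mm.
Qed.
Lemma osc_ae_eq c d u v : null (fun x => (Rlt c x /\ Rlt x d) /\ u x <> v x) ->
  osc c d u = osc c d v.
Proof.
move=> uv.
have key (P : RR -> Prop) : null (fun x => (Rlt c x /\ Rlt x d) /\ P (u x)) <->
    null (fun x => (Rlt c x /\ Rlt x d) /\ P (v x)).
  split=> h; apply: null_sub (null_setU uv h) => x [cxd Px];
    have [E|E] := pselect (u x = v x); try (by left); right; split => //.
  - by rewrite E.
  - by rewrite -E.
rewrite /osc /ess_sup /ess_inf; congr (Rminus (Ropp (Rsup _)) (Rsup _)); apply/funext => y; apply/propext.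
- exact: (key (fun t => Rlt (Ropp y) t)).
- exact: (key (fun t => Rlt t y)).
Qed.
Lemma osc_nondecreasing c d u : c < d -> (forall x y, x <= y -> u x <= u y) ->
  ess_bounded c d u -> osc c d u <= u d - u c.
Proof.
move=> cd um bu; have [s1 _] := ess_sup_spec cd bu; have [i1 _] := ess_inf_spec cd bu.
have empty_null (A : set RR) : (forall x, ~ A x) -> null A.
  move=> A0; apply/nullP; rewrite (_ : A = set0) ?measure0//.
  by apply/seteqP; split => // x /A0.
rewrite /osc RminusE; apply: lerB.
  apply: s1; apply: empty_null => x [[/RltP cx /RltP xd] /RltP]; rewrite ltNge.
  by rewrite um// ltW.
apply: i1; apply: empty_null => x [[/RltP cx /RltP xd] /RltP]; rewrite ltNge.
by rewrite um// ltW.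
Qed.
Lemma aboveE r v M x : null (above (x - r) (x + r) v M) <->
  ~ fattening (R := RR) r [set y | M < v y] x.
Proof.
rewrite nullP /fattening /=.
have -> : above (x - r) (x + r) v M = [set y | M < v y] `&` `]x - r, x + r[%classic.
  apply/seteqP; split => y; rewrite /= in_itv/=.
    by move=> [[/RltP -> /RltP ->] /RltP].
  by move=> [/RltP h /andP[/RltP ? /RltP ?]].
by split=> [->|/negP]; [rewrite eqxx|rewrite negbK => /eqP].
Qed.
Lemma belowE r v M x : null (below (x - r) (x + r) v M) <->
  ~ fattening (R := RR) r [set y | v y < M] x.
Proof.
rewrite nullP /fattening /=.
have -> : below (x - r) (x + r) v M = [set y | v y < M] `&` `]x - r, x + r[%classic.
  apply/seteqP; split => y; rewrite /= in_itv/=.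
    by move=> [[/RltP -> /RltP ->] /RltP].
  by move=> [/RltP h /andP[/RltP ? /RltP ?]].
by split=> [->|/negP]; [rewrite eqxx|rewrite negbK => /eqP].
Qed.
Definition osc_fun r v (x : RR) : RR := osc (x - r) (x + r) v.

Lemma Linfty_loc_bounded v c d : Linfty_loc v -> ess_bounded c d v.
Proof.
by move=> [_ /(_ c d)[M h]]; exists M; apply: null_sub h => x [? [? ?]].
Qed.
Lemma leb_mfun_of v : Defs.measurable_fun v ->
  leb_mfun (R := RR) v.
Proof.
move=> mv; apply/(leb_measurable_funP (R := RR)) => t.
rewrite (_ : [set x | _] = [set x | Rlt t (v x)]); first exact: (measurable_set_leb (mv t)).
by apply/seteqP; split => x /= /RltP.
Qed.
(** The set [above] is defined by a strict inequality, so the level [t] is first lowered by an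
    arbitrary [e]. *)
Lemma osc_fun_crossing r v x (s t : RR) : 0 < r -> Linfty_loc v ->
  fattening (R := RR) r [set y | t <= v y] x -> fattening (R := RR) r [set y | v y < s] x ->
  t - s <= osc_fun r v x.
Proof.
move=> r0 lv ft fs; have xr : x - r < x + r by lra.
have bv := Linfty_loc_bounded (x - r) (x + r) lv.
apply/ler_addgt0Pr => e e0; rewrite -lerBlDr.
rewrite (_ : t - s - e = (t - e) - s); last by ring.
apply: osc_ge => //; last by move/belowE.
move/aboveE; apply; apply: fattening_sub ft => y /=; apply: lt_le_trans.
by rewrite ltrBlDr ltrDl.
Qed.
(** The oscillation is lower semicontinuous in [x]: two levels witnessing that it exceeds [t] remain
    witnesses nearby, because fattenings are open. *)
Lemma leb_nn_osc_fun r v : 0 < r -> Linfty_loc v -> leb_nn (osc_fun r v).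
Proof.
move=> r0 lv; have xr (x : RR) : x - r < x + r by lra.
have bv x := Linfty_loc_bounded (x - r) (x + r) lv.
split; first by move=> x; exact: (osc_ge0 (xr x) (bv x)).
have mv := leb_mfun_of (proj1 lv).
have mA M : measurable ([set y | M < v y] : set (@leb_type RR)).
  exact: (proj1 (leb_measurable_funP (R := RR) v) mv).
have mB M : measurable ([set y | v y < M] : set (@leb_type RR)).
  exact: (leb_mfun_lt (R := RR)).
apply/(leb_measurable_funP (R := RR)) => t; apply: open_leb_measurable.
rewrite openE => x /= tx.
have [M [m [tMm /aboveE nM /belowE nm]]] := osc_gt (xr x) (bv x) tx.
have /contrapT FM := nM; have /contrapT Fm := nm.
have [d1 d10 h1] := fattening_near r0 (mA M) FM.
have [d2 d20 h2] := fattening_near r0 (mB m) Fm.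
exists (Num.min d1 d2) => /=; first by rewrite lt_min d10.
move=> y /=; rewrite lt_min => /andP[y1 y2].
apply: (lt_le_trans tMm); apply: (osc_ge (xr y) (bv y)).
- by move/aboveE; apply; exact: h1.
- by move/belowE; apply; exact: h2.
Qed.
End oscillation.

(** * Minimality *)

Section assembly.
Implicit Types (u v W : RR -> RR) (r : RR).
Lemma double_well_of_hyp W : hyp_H W -> double_well W.
Proof.
move=> HW; have [Wc [Wm [W1 [Wpos _]]]] := HW; split.
- by move=> x; apply/continuity_pt_cvg; exact: Wc.
- by move=> t; apply/RleP; exact: well_nonneg.
- by move=> t /eqP tm /eqP t1; apply/RltP; exact: Wpos.
- exact: Wm.
- exact: W1.
- by move=> s t /RleP s0 /RleP st /RleP t1; apply/RleP; exact: well_decreasing.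
- by move=> s t /RleP s0 /RleP st /RleP t1; apply/RleP; exact: well_increasing.
Qed.
Lemma osc_termE r v x : osc_term r v x = (2 * r ^+ 2)^-1 * osc_fun r v x ^+ 2.
Proof. by rewrite /osc_term RdivE !RpowE mulrC. Qed.
Lemma leb_nn_osc_term r v : 0 < r -> Linfty_loc v -> leb_nn (osc_term r v).
Proof.
move=> r0 lv; have no := leb_nn_osc_fun r0 lv.
rewrite (_ : osc_term r v = (fun x => (2 * r ^+ 2)^-1 * osc_fun r v x ^+ 2)); last first.
  by apply/funext => x; exact: osc_termE.
apply: (nn_mfun_scale (nn_mfun_mul no no)).
by rewrite invr_ge0 mulr_ge0// exprn_ge0// ltW.
Qed.
Lemma leb_nn_well W v : double_well W -> Defs.measurable_fun v -> leb_nn (fun x => W (v x)).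
Proof. by move=> dW /leb_mfun_of mv; exact: (nn_mfun_well dW mv). Qed.
Lemma ER_ereal_energy r W v : 0 < r -> double_well W -> Linfty_loc v ->
  ER_ereal (energy r W v) = (leb_int (osc_term r v) + leb_int (fun x => W (v x)))%E.
Proof.
move=> r0 dW lv; rewrite /energy ER_ereal_plus !ER_ereal_integral//.
- by apply: leb_nn_well => //; exact: (proj1 lv).
- exact: leb_nn_osc_term.
Qed.
Lemma restrictE (a b : RR) (f : RR -> RR) :
  Defs.restrict a b f = (fun x => f x * \1_(`]a, b[%classic : set (@leb_type RR)) x).
Proof.
apply/funext => x; rewrite /Defs.restrict indicE.
case: excluded_middle_informative => h.
  rewrite mem_set ?mulr1//= in_itv/=.
  by case: h => /RltP -> /RltP ->.
rewrite memNset ?mulr0//= in_itv/= => /andP[/RltP ? /RltP ?].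
by apply: h.
Qed.
Lemma leb_nn_restrict (a b : RR) (f : RR -> RR) : leb_nn f -> leb_nn (Defs.restrict a b f).
Proof.
move=> nf; rewrite restrictE; apply: (nn_mfun_mul nf).
by apply: nn_mfun_indic; exact: (@itv_leb_measurable RR).
Qed.
(** The part of the integrand outside []a, b[], complementary to [restrict]; it is what two
    competitors share. *)
Definition offset (a b : RR) (f : RR -> RR) (x : RR) : RR :=
  f x * \1_(~` `]a, b[%classic : set (@leb_type RR)) x.
Lemma offset_out (a b : RR) (f : RR -> RR) (x : RR) : ~ (a < x < b) -> offset a b f x = f x.
Proof.
move=> xab; rewrite /offset indicE (_ : x \in _ = true); first exact: mulr1.
by apply/idP; rewrite inE => h; apply: xab; move: h; rewrite /= in_itv.
Qed.
Lemma offset_in (a b : RR) (f : RR -> RR) (x : RR) : a < x < b -> offset a b f x = 0.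
Proof.
move=> xab; rewrite /offset indicE (_ : x \in _ = false); first exact: mulr0.
by apply/negbTE/negP; rewrite inE => h; apply: h; rewrite /= in_itv.
Qed.
Lemma leb_nn_offset (a b : RR) (f : RR -> RR) : leb_nn f -> leb_nn (offset a b f).
Proof.
move=> nf; apply: (nn_mfun_mul nf).
by apply: nn_mfun_indic; apply: measurableC; exact: (@itv_leb_measurable RR).
Qed.
Lemma leb_int_restrict_offset (a b : RR) (f : RR -> RR) : leb_nn f ->
  leb_int f = (leb_int (Defs.restrict a b f) + leb_int (offset a b f))%E.
Proof.
move=> nf; have nr := leb_nn_restrict a b nf; have no := leb_nn_offset a b nf.
rewrite /leb_int -(nnint_add (@leb RR) nr no); congr (nnint _ _).
apply/funext => x; rewrite restrictE /offset -mulrDr !indicE in_setC.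
by case: (_ \in _); rewrite /= ?addr0 ?add0r mulr1.
Qed.
Lemma ER_ereal_energy_ab r W (a b : RR) v : 0 < r -> double_well W -> Linfty_loc v ->
  ER_ereal (energy_ab r W a b v) =
  (leb_int (Defs.restrict a b (osc_term r v)) +
   leb_int (Defs.restrict a b (fun x => W (v x))))%E.
Proof.
move=> r0 dW lv; rewrite /energy_ab ER_ereal_plus !ER_ereal_integral//.
- by apply: leb_nn_restrict; apply: leb_nn_well => //; exact: (proj1 lv).
- by apply: leb_nn_restrict; exact: leb_nn_osc_term.
Qed.
Lemma empty_null (A : set RR) : (forall x, ~ A x) -> null A.
Proof.
move=> A0; apply/nullP; rewrite (_ : A = set0) ?measure0//.
by apply/seteqP; split => // x /A0.
Qed.
Lemma nondecreasing_measurable_fun u : (forall x y, x <= y -> u x <= u y) -> Defs.measurable_fun u.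
Proof.
move=> um t; apply: upset_measurable_set => x y xy /RltP tx; apply/RltP.
exact: lt_le_trans (um _ _ xy).
Qed.
Lemma nondecreasing_Linfty_loc u : (forall x y, x <= y -> u x <= u y) -> Linfty_loc u.
Proof.
move=> um; split; first exact: nondecreasing_measurable_fun.
move=> a b; exists (`|u a| + `|u b|); apply: empty_null => x [[/RltP ax /RltP xb] /RltP].
rewrite RabsE ltNge => /negP; apply.
have := um _ _ (ltW ax); have := um _ _ (ltW xb).
have := ler_norm (u b); have := ler_norm (- u a); rewrite normrN => h1 h2 h3 h4.
have := normr_ge0 (u a); have := normr_ge0 (u b) => h5 h6.
by rewrite ler_norml; apply/andP; split; lra.
Qed.
Lemma admissible_Linfty u : admissible u -> Linfty u.
Proof.
move=> au; split; first exact: (nondecreasing_measurable_fun (adm_homo au)).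
exists 1; apply: empty_null => x /RltP; rewrite RabsE ltNge => /negP; apply.
by rewrite ler_norml; exact: (adm_bound au).
Qed.
Lemma energy_le_increment_energy r W u : 0 < r -> double_well W -> admissible u ->
  (ER_ereal (energy r W u) <= increment_energy W r u)%E.
Proof.
move=> r0 dW au; have lu := nondecreasing_Linfty_loc (adm_homo au).
rewrite ER_ereal_energy// increment_energyE//; apply: leeD; last exact: lexx.
have k0 : 0 <= (2 * r ^+ 2)^-1 by rewrite invr_ge0 mulr_ge0// exprn_ge0// ltW.
have ni := nn_mfun_sqr_increment r au.
rewrite -(nnint_scale _ ni k0).
apply: (nnint_le (@leb RR) (leb_nn_osc_term r0 lu) (nn_mfun_scale ni k0)) => x.
rewrite osc_termE; apply: ler_wpM2l => //.
have xr : (x : RR) - r < (x : RR) + r by lra.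
have bu := Linfty_loc_bounded (x - r) (x + r) lu.
have o0 := osc_ge0 xr bu; have o1 := osc_nondecreasing xr (adm_homo au) bu.
by apply: lerXn2r; rewrite ?nnegrE// (le_trans o0).
Qed.
Lemma increment_energy_le_energy r W u v : 0 < r -> double_well W -> admissible u ->
  (forall w, admissible w -> (increment_energy W r u <= increment_energy W r w)%E) ->
  Linfty_loc v ->
  (forall k : RR, 0 < k < 1 -> exists2 L : RR, 0 <= L &
    lebR ([set y | v y < k] `&` `]L, +oo[%classic) = 0%E /\
    lebR ([set y | - k < v y] `&` `]-oo, - L[%classic) = 0%E) ->
  (increment_energy W r u <= ER_ereal (energy r W v))%E.
Proof.
move=> r0 dW au umin lv tails; rewrite ER_ereal_energy//.
have k0 : 0 <= (2 * r ^+ 2)^-1 by rewrite invr_ge0 mulr_ge0// exprn_ge0// ltW.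
have no := leb_nn_osc_fun r0 lv.
have := minimizer_le dW r0 au umin (leb_mfun_of (proj1 lv)) no
  (fun x s1 s2 => osc_fun_crossing r0 lv) tails.
rewrite -(nnint_scale _ (nn_mfun_mul no no) k0) => h; apply: (le_trans h).
rewrite le_eqVlt; apply/orP; left; apply/eqP; congr (_ + _)%E.
by congr (nnint _ _); apply/funext => x; rewrite osc_termE.
Qed.
(** Far enough out [v] agrees almost everywhere with [u], which is close to -1 or 1 there. Taking
    [v] equal to [u] covers a competitor known through its own limits. *)
Lemma tails_of_limits u v (a b : RR) : has_limits_pm1 u ->
  null (fun x => ~ (Rle a x /\ Rle x b) /\ u x <> v x) ->
  forall k : RR, 0 < k < 1 -> exists2 L : RR, 0 <= L &
    lebR ([set y | v y < k] `&` `]L, +oo[%classic) = 0%E /\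
    lebR ([set y | - k < v y] `&` `]-oo, - L[%classic) = 0%E.
Proof.
move=> [lp lm] uv k /andP[k0 k1].
pose q := 1 - k.
have e0 : Rlt (IZR 0) q by apply/RltP; rewrite subr_gt0.
have [M1 h1] := lp _ e0; have [M2 h2] := lm _ e0.
pose L := `|M1| + `|M2| + `|a| + `|b|.
have [n1 n2 n3 n4] : [/\ 0 <= `|M1|, 0 <= `|M2|, 0 <= `|a| & 0 <= `|b|] by split; exact: normr_ge0.
have c1 := ler_norm M1; have c2 := ler_norm (- M2); have c3 := ler_norm (- a); have c4 := ler_norm b.
rewrite !normrN in c2 c3.
exists L; first by rewrite !addr_ge0.
split; apply/nullP; apply: null_sub uv => x [vx]; rewrite /= in_itv/= ?andbT => xL.
- have xb : b < x by apply: le_lt_trans xL; rewrite /L; lra.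
  have xM : M1 < x by apply: le_lt_trans xL; rewrite /L; lra.
  split; first by move=> [_ /RleP]; rewrite leNgt xb.
  have xM' : Rlt M1 x by apply/RltP.
  move=> E; have /RltP := h1 x xM'.
  by rewrite RabsE E ltr_norml => /andP[+ _]; move: vx => /=; rewrite /q RminusE (_ : IZR 1 = 1)//; lra.
- have xa : x < a by apply: (lt_le_trans xL); rewrite /L; lra.
  have xM : x < M2 by apply: (lt_le_trans xL); rewrite /L; lra.
  split; first by move=> [/RleP]; rewrite leNgt xa.
  have xM' : Rlt x M2 by apply/RltP.
  move=> E; have /RltP := h2 x xM'.
  by rewrite RabsE E ltr_norml => /andP[_ +]; move: vx => /=; rewrite /q RplusE (_ : IZR 1 = 1)//; lra.
Qed.
(** For [x] outside []a, b[] the window misses [[a + r, b - r]], so [u] and [v] have the same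
    oscillation there, and almost everywhere the same potential. The common contribution is finite
    and can be subtracted. *)
Lemma local_minimizer_of_global r W u : 0 < r -> double_well W ->
  Linfty_loc u -> (ER_ereal (energy r W u) < +oo)%E ->
  (forall v (a b : RR), Linfty_loc v -> null (fun x => ~ (Rle a x /\ Rle x b) /\ u x <> v x) ->
    (ER_ereal (energy r W u) <= ER_ereal (energy r W v))%E) ->
  local_minimizer r W u.
Proof.
move=> r0 dW lu fin glob a b v ab lv uv; apply/ER_leP.
rewrite !ER_ereal_energy_ab//.
have := glob v _ _ lv uv; rewrite (ER_ereal_energy r0 dW lu) (ER_ereal_energy r0 dW lv).
have nu1 := leb_nn_osc_term r0 lu; have nv1 := leb_nn_osc_term r0 lv.
have nu2 := leb_nn_well dW (proj1 lu); have nv2 := leb_nn_well dW (proj1 lv).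
have E1 : leb_int (offset a b (osc_term r v)) = leb_int (offset a b (osc_term r u)).
  congr (leb_int _); apply/funext => x.
  have [xab|xab] := pselect (a < x < b); first by rewrite !offset_in.
  rewrite !offset_out// !osc_termE; congr (_ * _ ^+ 2); apply/esym/osc_ae_eq.
  apply: null_sub uv => y [[/RltP y1 /RltP y2] uvy]; split => // -[/RleP h1 /RleP h2].
  apply: xab; apply/andP; split.
    by rewrite -(ltrD2r r); exact: le_lt_trans h1 y2.
  by rewrite -(ltrD2r (- r)); exact: lt_le_trans y1 h2.
have E2 : leb_int (offset a b (fun x => W (v x))) = leb_int (offset a b (fun x => W (u x))).
  have N0 : lebR (fun x => ~ (Rle (Rplus a r) x /\ Rle x (Rminus b r)) /\ u x <> v x) = 0%E.
    exact/nullP.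
  have mN := leb_eq0_measurable (R := RR) N0.
  apply: (nnint_ae_eq (leb_nn_offset a b nv2) (leb_nn_offset a b nu2) mN N0) => x nN.
  have [xab|xab] := pselect ((a < x < b) : bool); first by rewrite !offset_in.
  rewrite !offset_out//; congr W; apply: contrapT => uvx; apply: nN; split.
    move=> [/RleP h1 /RleP h2]; apply: xab; apply/andP; split.
      by apply: lt_le_trans h1; rewrite ltrDl.
    by apply: (le_lt_trans h2); rewrite ltrBlDr ltrDl.
  by move=> h; apply: uvx.
move: fin; rewrite (ER_ereal_energy r0 dW lu).
rewrite (leb_int_restrict_offset a b nu1) (leb_int_restrict_offset a b nu2).
rewrite (leb_int_restrict_offset a b nv1) (leb_int_restrict_offset a b nv2) E1 E2.
rewrite !(addeACA _ (leb_int (offset _ _ _))).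
set O := (leb_int (offset a b (osc_term r u)) + leb_int (offset a b (fun x => W (u x))))%E.
set X := (_ + leb_int (Defs.restrict a b (fun x => W (u x))))%E => fin.
have O0 : (0 <= O)%E.
  apply: adde_ge0; apply: nnint_ge0; [exact: (leb_nn_offset a b nu1).1|exact: (leb_nn_offset a b nu2).1].
have X0 : (0 <= X)%E.
  apply: adde_ge0; apply: nnint_ge0; [exact: (leb_nn_restrict a b nu1).1|exact: (leb_nn_restrict a b nu2).1].
have Ofin : O \is a fin_num.
  by rewrite ge0_fin_numE//; apply: le_lt_trans fin; exact: leeDr.
by rewrite leeD2rE.
Qed.
Lemma riemann_sumE W (h : RR) k :
  \sum_(m < k) W (-1 + h * m.+1%:R) * h = riemann_sum W h k.
Proof.
by elim: k => [|k IH]; rewrite ?big_ord0// big_ord_recr IH -INRE.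
Qed.
Lemma le_four_plus_RiemannInt r W u (e : RR) (pr : Riemann_integrable W (-1) 1) :
  0 < r -> hyp_H W -> admissible u ->
  (forall w, admissible w -> (increment_energy W r u <= increment_energy W r w)%E) ->
  (e%:E <= increment_energy W r u)%E -> e <= 4%:R + RiemannInt pr.
Proof.
move=> r0 HW au umin eu; have dW := double_well_of_hyp HW.
apply/ler_addgt0Pr => d d0.
(* The excess per unit of [h]: [2 / r] from the squared increments and [W 0] from the Riemann
   sum. *)
pose Q := 2 / r + W 0.
have Q0 : 0 < Q by rewrite addr_gt0// ?divr_gt0//; apply: (dw_gt0 dW); apply/eqP; lra.
pose N := (Num.truncn (Q / d)).+1.
have N0 : 0 < N%:R :> RR by rewrite ltr0n.
have hN : N%:R^-1 * N%:R = 1 :> RR by rewrite mulVf// gt_eqF.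
have Qh : Q * N%:R^-1 <= d.
  rewrite ler_pdivrMr// mulrC -ler_pdivrMr//.
  by rewrite ltW// truncnS_gt.
have [w [aw]] := increment_energy_uniform_step dW r0 (ltn0Sn _) hN.
move=> /(le_trans (umin _ aw))/(le_trans eu); rewrite lee_fin => h1.
have NP : (0 < N)%coq_nat by apply/ssrnat.ltP.
have hN' : Rmult (N%:R^-1) (INR N) = IZR 1 by rewrite INRE.
have h2 : \sum_(m < (N + N).-1) W (-1 + N%:R^-1 * m.+1%:R) * N%:R^-1 <=
    RiemannInt pr + N%:R^-1 * W 0.
  by rewrite riemann_sumE; apply/RleP; exact: (riemann_sum_le W _ N pr HW NP hN').
set h := N%:R^-1 in h1 h2 Qh.
have Qh' : 2 * h / r + h * W 0 <= d.
  by apply: le_trans Qh; rewrite le_eqVlt; apply/orP; left; apply/eqP; rewrite /Q; ring.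
have aux (x y z s e' d' : RR) : e' <= 4 + x + s -> s <= z + y -> x + y <= d' ->
    e' <= 4 + z + d' by lra.
exact: (aux _ _ _ _ _ _ h1 h2 Qh').
Qed.
End assembly.

Lemma admissible_has_limits (u W : RR -> RR) (r : RR) : double_well W -> admissible u ->
  (increment_energy W r u < +oo)%E -> has_limits_pm1 u.
Proof.
move=> dW au fin; have [lp lm] := admissible_limits dW au fin.
split=> eps /RltP e0.
- have [M h] := lp _ e0; exists M => x /RltP Mx; apply/RltP; rewrite RabsE RminusE.
  exact: h.
- have [M h] := lm _ e0; exists M => x /RltP Mx; apply/RltP; rewrite RabsE RplusE.
  exact: h.
Qed.
Open Scope R_scope.

Theorem theorem1p1 (r : R) (W : R -> R) (hr : 0 < r) (hW : hyp_H W) :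
  exists u : R -> R,
    Linfty u /\ local_minimizer r W u /\
    nondecreasing u /\ has_limits_pm1 u /\
    exists e : R,
      energy r W u = Fin e /\
      (forall v : R -> R, nondecreasing v -> has_limits_pm1 v ->
          ER_le (Fin e) (energy r W v)) /\
      exists pr : Riemann_integrable W (-1) 1,
        e <= Rmin (4 / r) (4 + RiemannInt pr).
Proof.
have dW := double_well_of_hyp hW; move/RltP: hr => hr.
have [u [au umin]] := exists_minimizer r dW.
have u4 : (increment_energy W r u <= (4%:R / r)%R%:E)%E.
  by apply: le_trans (umin _ (@admissible_sign_step RR)) _; exact: increment_energy_sign_step.
have ufin : (increment_energy W r u < +oo)%E by apply: le_lt_trans u4 _; exact: ltry.
have um := adm_homo au.
have ulim : has_limits_pm1 u by exact: admissible_has_limits ufin.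
have lu := nondecreasing_Linfty_loc um.
have Eu := energy_le_increment_energy hr dW au.
have [e eE] : exists e : R, energy r W u = Fin e.
  case E : (energy r W u) => [e|]; first by exists e.
  by move: (le_lt_trans Eu ufin); rewrite E.
(* The function [w] only supplies the tails of [v]: it is [u] for a local perturbation and [v]
   itself for a monotone competitor. *)
have glob (v : R -> R) (w : R -> R) (a b : R) : Linfty_loc v -> has_limits_pm1 w ->
    null (fun x => ~ (Rle a x /\ Rle x b) /\ w x <> v x) ->
    (ER_ereal (energy r W u) <= ER_ereal (energy r W v))%E.
  move=> lv lw wv; apply: le_trans Eu _.
  apply: (increment_energy_le_energy hr dW au umin lv).
  exact: (tails_of_limits lw wv).
exists u; split; first exact: admissible_Linfty.
split.
  apply: (local_minimizer_of_global hr dW lu); first exact: le_lt_trans Eu ufin.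
  by move=> v a b lv; exact: glob.
split; first by move=> x y /RleP xy; apply/RleP; exact: um.
split; first exact: ulim.
exists e; split; first exact: eE.
split.
  move=> v vm vlim; rewrite -eE; apply/ER_leP.
  have vm' (x y : R) : (x <= y)%R -> (v x <= v y)%R by move=> /RleP xy; apply/RleP; exact: vm.
  apply: (glob v v 0 0 (nondecreasing_Linfty_loc vm') vlim).
  by apply: empty_null => x [_].
have ab : Rle (-1) 1 by apply: Rlt_le; Lra.lra.
exists (continuity_implies_RiemannInt ab (fun x _ => proj1 hW x)).
have ei : (e%:E <= increment_energy W r u)%E by move: Eu; rewrite eE.
apply: Rmin_glb; apply/RleP.
- by rewrite RdivE IZR4 -lee_fin; exact: le_trans ei u4.
- by rewrite RplusE IZR4; exact: (le_four_plus_RiemannInt _ hr hW au umin ei).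
Qed.
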